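(* Let $\lambda$ be a partition with $\lambda_2\le 3$ and $\lambda_1\ge 3$, let $\lambda'$ be its conjugate, $r^*=\lambda_1-3$, and let $V_\lambda$ be the covariant tensor representation of $\mathfrak{gl}(1|3)$ labeled by $\lambda$. Let $m_\lambda(E,j)$ be the multiplicity of the $(2j+1)$-dimensional irreducible representation of $\mathfrak{so}(3)\subset\mathfrak u(3)\subset\mathfrak{gl}(1|3)$ in the eigenspace of $\hat H$ in $V_\lambda$ with eigenvalue $\hbar\omega E$. Then $\sum_{E,j}m_\lambda(E,j)z^EJ^j$ equals $z^{\frac{|\lambda|}{2}+r^*}$ times the coefficient of $A_1^{\lambda_1'}A_2^{\lambda_2'}A_3^{\lambda_3'}$ in the formal power series expansion (in $A_1,A_2,A_3$) of $$\frac{(1+A_1 z)(1+A_2 z)(1+A_3z)(1+A_1^2 A_2 \, J)}{(1 - A_1 A_2 A_3)(1 - A_1 \, J)(1 - A_1 A_2 \, J)(1 - A_1^2)(1 - A_1^2 A_2^2)}.$$ For $\ell(\lambda')=\lambda_1=2$ (respectively $\ell(\lambda')=\lambda_1=1$) the same holds with $r^*=0$, after setting $A_3=0$ (respectively $A_2=A_3=0$) in this function and taking the coefficient of $A_1^{\lambda_1'}A_2^{\lambda_2'}$ (respectively $A_1^{\lambda_1'}$).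
   Context: $\mathfrak{gl}(1|n)$ has basis $e_{jk}$, $j,k=0,1,\dots,n$, with odd elements $e_{0j},e_{j0}$ ($j\geq 1$) and bracket $[\![e_{ij},e_{kl}]\!]=\delta_{jk}e_{il}-(-1)^{\deg(e_{ij})\deg(e_{kl})}\delta_{il}e_{kj}$. The irreducible covariant tensor representations $V_\lambda$ are labeled by partitions $\lambda$ with $\lambda_2\le n$; the character (known) is the supersymmetric Schur function $s_\lambda(x_1|y_1,\dots,y_n)=\sum_{r}x_1^r\sum_\nu s_{\nu'}(y_1,\dots,y_n)$, the inner sum being over partitions $\nu$ such that $\lambda-\nu$ is a horizontal $r$-strip (skew diagram with $r$ boxes, at most one per column), where $x_1$ tracks the $e_{00}$-weight and $y_j$ the $e_{jj}$-weight. $|\lambda|$ is the sum of the parts of $\lambda$ and $\ell$ denotes the number of parts. The Hamiltonian is $\hat H=\frac{\hbar\omega}{n-1}\bigl(n\,e_{00}+\sum_{j=1}^n e_{jj}\bigr)$, with constants $\hbar,\omega>0$; so the component with $x_1$-exponent $r$ has energy $\hbar\omega(\frac{|\lambda|}{n-1}+r)$. Here $n=3$; $\mathfrak u(3)$ is spanned by the $e_{jk}$ with $j,k\in\{1,2,3\}$ and $\mathfrak{so}(3)\subset\mathfrak u(3)$ is the subalgebra spanned by the antisymmetric combinations $e_{jk}-e_{kj}$ (up to a scalar, these are the angular momentum operators). *)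

(* Defs.v *)
From HB Require Import structures.
From mathcomp Require Import all_boot all_order all_algebra.
From mathcomp.multinomials Require Import mpoly.

Set Implicit Arguments.
Unset Strict Implicit.
Unset Printing Implicit Defensive.

Import Order.TTheory GRing.Theory Num.Theory.
Local Open Scope ring_scope.

(** * Partitions *)

(* Partitions are nonincreasing sequences of naturals; trailing zeros are
   allowed and irrelevant.  [part la i] is the part $\lambda_i$, with i >= 1. *)
Definition is_partition (la : seq nat) : bool := sorted geq la.

Definition part (la : seq nat) (i : nat) : nat := nth 0%N la i.-1.

Definition conj_part (la : seq nat) : seq nat :=
  [seq count (fun p => j < p)%N la | j <- iota 0 (part la 1)].

(* Every partition contained in la occurs exactly once in [bounded_seqs la],
   padded with zeros to the length of la. *)
Definition bounded_seqs (la : seq nat) : seq (seq nat) :=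
  [seq [seq val p | p <- tval t]
     | t <- enum {: (size la).-tuple 'I_(part la 1).+1}].

(* The skew diagram la - nu is defined and has at most one box per column. *)
Definition horizontal_strip (la nu : seq nat) : bool :=
  all (fun i => part nu i.+1 <= part la i.+1)%N
      (iota 0 (maxn (size la) (size nu))) &&
  all (fun j => part (conj_part la) j.+1 - part (conj_part nu) j.+1 <= 1)%N
      (iota 0 (part la 1)).

(** * Schur and supersymmetric Schur functions *)

Definition cell (la : seq nat) := {i : 'I_(size la) & 'I_(nth 0%N la i)}.

Definition cell_row (la : seq nat) (c : cell la) : nat := val (tag c).
Definition cell_col (la : seq nat) (c : cell la) : nat := val (tagged c).

Definition semistandard (la : seq nat) (n : nat)
    (T : {ffun cell la -> 'I_n}) : bool :=
  [forall c, forall d,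
     ((cell_row c == cell_row d) && (cell_col c < cell_col d)%N
        ==> (T c <= T d)%N) &&
     ((cell_col c == cell_col d) && (cell_row c < cell_row d)%N
        ==> (T c < T d)%N)].

Definition schur (A : comNzRingType) (n : nat) (la : seq nat)
    (y : 'I_n -> A) : A :=
  \sum_(T : {ffun cell la -> 'I_n} | semistandard T) \prod_(c : cell la) y (T c).

Definition super_schur (A : comNzRingType) (n : nat) (la : seq nat)
    (x : A) (y : 'I_n -> A) : A :=
  \sum_(nu <- bounded_seqs la | is_partition nu && horizontal_strip la nu)
     x ^+ (sumn la - sumn nu) * schur (conj_part nu) y.

(* As a polynomial, with x_1 the variable of index 0 and y_j that of index j. *)
Definition super_schur_poly (n : nat) (la : seq nat) : {mpoly int[n.+1]} :=
  super_schur la 'X_ord0 (fun j : 'I_n => 'X_(lift ord0 j)).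

(** * Representations of gl(1|n) *)

Section Gl1n.
Variables (C : fieldType) (n : nat).

Definition idx_odd (i : 'I_n.+1) : bool := i != ord0.

Definition unit_odd (i j : 'I_n.+1) : bool := idx_odd i (+) idx_odd j.

(* A finite-dimensional representation, given by the images [act i j] of the
   basis elements e_{ij} on a Z/2-graded space. *)
Record gl_rep := GlRep {
  rep_space :> vectType C;
  rep_part : bool -> {vspace rep_space};
  act : 'I_n.+1 -> 'I_n.+1 -> 'End(rep_space);
  rep_grading :
    (rep_part false + rep_part true = fullv)%VS /\
    (rep_part false :&: rep_part true = 0)%VS;
  act_parity : forall i j (b : bool),
    (act i j @: rep_part b <= rep_part (unit_odd i j (+) b))%VS;
  act_bracket : forall i j k l,
    let s := (-1) ^+ (unit_odd i j && unit_odd k l) in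
    (act i j \o act k l)%VF - s *: (act k l \o act i j)%VF =
    (j == k)%:R *: act i l - s *: ((i == l)%:R *: act k j)
}.

Definition gl_stable (V : gl_rep) (U : {vspace V}) : Prop :=
  forall i j, (act V i j @: U <= U)%VS.

Definition graded_subspace (V : gl_rep) (U : {vspace V}) : Prop :=
  (U = (U :&: rep_part V false) + (U :&: rep_part V true))%VS.

Definition gl_irreducible (V : gl_rep) : Prop :=
  ({:V} != 0)%VS /\
  forall U : {vspace V},
    gl_stable U -> graded_subspace U -> U = 0%VS \/ U = fullv.

(* The N-th tensor power of the natural representation C^{1|n}: the function t
   stands for the sum over words w of t(w) v_{w_1} (x) ... (x) v_{w_N}, where
   v_0 is even and v_1, ..., v_n are odd. *)
Definition tensor (N : nat) := {ffun {ffun 'I_N -> 'I_n.+1} -> C^o}.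

(* e_{ij} acts as a superderivation:
   e_{ij}(v_{u_1} (x) ... (x) v_{u_N}) =
     sum_p (-1)^{deg e_{ij} (deg v_{u_1} + ... + deg v_{u_{p-1}})}
       v_{u_1} (x) ... (x) e_{ij} v_{u_p} (x) ... (x) v_{u_N};
   the coefficient at w collects the p with w_p = i, coming from u_p = j. *)
Definition tensor_act (N : nat) (i j : 'I_n.+1) (t : tensor N) : tensor N :=
  [ffun w : {ffun 'I_N -> 'I_n.+1} =>
     \sum_(p : 'I_N | w p == i)
       (-1) ^+ (unit_odd i j * \sum_(q : 'I_N | (q < p)%N) idx_odd (w q))%N *
       t [ffun q => if q == p then j else w q]].

(* V is isomorphic to an irreducible subrepresentation of a tensor power of the
   natural representation.  The embedding is not required to be homogeneous:
   this leaves the parity of V free. *)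
Definition covariant_tensor_rep (V : gl_rep) : Prop :=
  gl_irreducible V /\
  exists (N : nat) (f : 'Hom(V, tensor N)),
    lker f = 0%VS /\ forall i j v, f (act V i j v) = tensor_act i j (f v).

Definition weight_space (V : gl_rep) (mu : 'X_{1..n.+1}) : {vspace V} :=
  (\bigcap_(i < n.+1) passmx.leigenspace (act V i i) (mu i)%:R)%VS.

(* All weights of a covariant tensor representation are tuples of naturals, so
   its character is a polynomial. *)
Definition has_character (V : gl_rep) (p : {mpoly int[n.+1]}) : Prop :=
  forall mu : 'X_{1..n.+1}, Posz (\dim (weight_space V mu)) = p@_mu.

(* V is the covariant tensor representation labeled by la; the label of a
   covariant tensor representation is read off from its character. *)
Definition is_V_lambda (la : seq nat) (V : gl_rep) : Prop :=
  covariant_tensor_rep V /\ has_character V (super_schur_poly n la).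

(** ** The Hamiltonian and the subalgebra so(n) *)

Definition Hamiltonian (V : gl_rep) (hbar omega : C) : 'End(V) :=
  (hbar * omega / (n%:R - 1)) *:
    (n%:R *: act V ord0 ord0 +
     \sum_(j < n) act V (lift ord0 j) (lift ord0 j)).

Definition energy_space (V : gl_rep) (hbar omega E : C) : {vspace V} :=
  passmx.leigenspace (Hamiltonian V hbar omega) (hbar * omega * E).

Definition so_stable (V : gl_rep) (U : {vspace V}) : Prop :=
  forall j k : 'I_n,
    ((act V (lift ord0 j) (lift ord0 k) - act V (lift ord0 k) (lift ord0 j))
       @: U <= U)%VS.

Definition so_irreducible (V : gl_rep) (W : {vspace V}) : Prop :=
  [/\ so_stable W, W != 0%VS &
      forall U : {vspace V}, (U <= W)%VS -> so_stable U -> U = 0%VS \/ U = W].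

Definition so_decomposition (V : gl_rep) (U : {vspace V}) (k : nat)
    (W : 'I_k -> {vspace V}) : Prop :=
  [/\ (\sum_(i < k) W i = U)%VS, directv (\sum_(i < k) W i) &
      forall i, so_irreducible (W i)].

(* For n = 3, so(n) has a single irreducible representation of each dimension
   d, and [so_multiplicity U d m] says that its multiplicity in U is m: the
   space U is a direct sum of irreducibles, and every such decomposition has
   exactly m summands of dimension d. *)
Definition so_multiplicity (V : gl_rep) (U : {vspace V}) (d : nat) (m : int) :
    Prop :=
  (exists (k : nat) (W : 'I_k -> {vspace V}), so_decomposition U W) /\
  (forall (k : nat) (W : 'I_k -> {vspace V}), so_decomposition U W ->
     Posz #|[set i | \dim (W i) == d]| = m).

End Gl1n.

(** * Formal power series expansion of a quotient of polynomials *)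

Section Expansion.
Variables (A : comNzRingType) (k : nat).
Implicit Types (P Q : {mpoly A[k]}) (m : 'X_{1..k}).

Fixpoint expansion_rec (fuel : nat) P Q m : A :=
  if fuel is f.+1 then
    P@_m - \sum_(h : 'X_{1..k < (mdeg m).+1, (mdeg m).+1}
                  | (m == (h.1 + h.2)%MM) && (val h.1 != 0%MM))
              Q@_h.1 * expansion_rec f P Q h.2
  else 0.

(* The coefficient of the monomial m in P / Q, for Q with constant term 1;
   [expansionP] and [expansion_unique] characterize it. *)
Definition expansion P Q m : A := expansion_rec (mdeg m).+1 P Q m.

Let mdeg_lt_addl m (a b : 'X_{1..k}) :
  m = (a + b)%MM -> a != 0%MM -> (mdeg b < mdeg m)%N.
Proof.
by move=> -> an0; rewrite mdegD -[X in (X < _)%N]add0n ltn_add2r lt0n mdeg_eq0.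
Qed.

Lemma expansion_rec_fuel f1 f2 P Q m :
  (mdeg m < f1)%N -> (mdeg m < f2)%N ->
  expansion_rec f1 P Q m = expansion_rec f2 P Q m.
Proof.
elim: f1 f2 m => [//|f1 IH] [//|f2] m; rewrite !ltnS => h1 h2 /=.
congr (_ - _); apply: eq_bigr => h /andP[/eqP hm hn0].
have lt2 := mdeg_lt_addl hm hn0.
by congr (_ * _); apply: IH; apply: leq_trans lt2 _.
Qed.

Definition is_expansion P Q (F : 'X_{1..k} -> A) : Prop :=
  forall m,
    \sum_(h : 'X_{1..k < (mdeg m).+1, (mdeg m).+1} | m == (h.1 + h.2)%MM)
       Q@_h.1 * F h.2 = P@_m.

Let zero_split m :
  { h : 'X_{1..k < (mdeg m).+1} * 'X_{1..k < (mdeg m).+1}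
  | val h.1 = 0%MM & val h.2 = m }.
Proof.
have h0 : (mdeg (0%MM : 'X_{1..k}) < (mdeg m).+1)%N by rewrite mdeg0.
by exists (BMultinom h0, BMultinom (ltnSn (mdeg m))).
Qed.

Let expansion_split P Q (F : 'X_{1..k} -> A) m :
  Q@_0%MM = 1 ->
  \sum_(h : 'X_{1..k < (mdeg m).+1, (mdeg m).+1} | m == (h.1 + h.2)%MM)
     Q@_h.1 * F h.2 =
  F m + \sum_(h : 'X_{1..k < (mdeg m).+1, (mdeg m).+1}
                | (m == (h.1 + h.2)%MM) && (val h.1 != 0%MM)) Q@_h.1 * F h.2.
Proof.
move=> Q1; case: (zero_split m) => h0 h01 h02.
rewrite (bigD1 h0) /=; last by rewrite h01 h02 add0m.
rewrite h01 h02 Q1 mul1r; congr (_ + _); apply: eq_bigl => h.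
apply: andb_id2l => /eqP hm; congr (~~ _); apply/eqP/eqP => [-> //|h10].
case: h h0 hm h01 h02 h10 => [a b] [a0 b0] /= hm h01 h02 h10.
rewrite h10 add0m in hm.
by congr (_, _); apply: val_inj; rewrite /= ?h01 ?h02 ?h10.
Qed.

Lemma expansionP P Q : Q@_0%MM = 1 -> is_expansion P Q (expansion P Q).
Proof.
move=> Q1 m; rewrite expansion_split // {1}/expansion /= -addrA.
rewrite [X in _ + X](_ : _ = 0) ?addr0 //; apply/eqP; rewrite addrC subr_eq0.
apply/eqP/eq_bigr => h /andP[/eqP hm hn0]; congr (_ * _).
by apply: expansion_rec_fuel => //; apply: mdeg_lt_addl hm hn0.
Qed.

Lemma expansion_unique P Q F :
  Q@_0%MM = 1 -> is_expansion P Q F -> F =1 expansion P Q.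
Proof.
move=> Q1 FP m; have [d] := ubnP (mdeg m); elim: d m => // d IH m ltmd.
have := FP m; rewrite -(expansionP P Q1) !expansion_split //.
set s1 := \sum_(h | _) _; set s2 := \sum_(h | _) _.
suff -> : s1 = s2 by move/addIr.
apply: eq_bigr => h /andP[/eqP hm hn0]; congr (_ * _); apply: IH.
rewrite ltnS in ltmd; apply: leq_trans ltmd.
exact: mdeg_lt_addl hm hn0.
Qed.

End Expansion.

(** * The generating function *)

Definition gf_num (B : comNzRingType) (A1 A2 A3 z J : B) : B :=
  (1 + A1 * z) * (1 + A2 * z) * (1 + A3 * z) * (1 + A1 ^+ 2 * A2 * J).

Definition gf_den (B : comNzRingType) (A1 A2 A3 z J : B) : B :=
  (1 - A1 * A2 * A3) * (1 - A1 * J) * (1 - A1 * A2 * J) *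
  (1 - A1 ^+ 2) * (1 - A1 ^+ 2 * A2 ^+ 2).

(* Polynomials in z (outer variable) with coefficients in Z[J]. *)
Definition polyzJ := {poly {poly int}}.

(* The variable A_i, or 0 if it is not among the k variables kept. *)
Definition gf_var (k i : nat) : {mpoly polyzJ[k]} :=
  if insub i.-1 is Some j then 'X_(j : 'I_k) else 0.

(* The denominator has constant term 1, so [expansionP] applies to it. *)
Lemma gf_den_coef0 k (z J : polyzJ) :
  (gf_den (gf_var k 1) (gf_var k 2) (gf_var k 3) z%:MP J%:MP)@_0%MM = 1.
Proof.
have v0 i : (gf_var k i)@_0%MM = 0.
  rewrite /gf_var; case: insub => [j|]; last by rewrite mcoeff0.
  by rewrite mcoeffX mnm1_eq0.
have M (p q : {mpoly polyzJ[k]}) : (p * q)@_0%MM = p@_0%MM * q@_0%MM.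
  exact: (@mcoeff0_is_multiplicative k polyzJ).1.
by rewrite /gf_den !expr2 !(M, mcoeffB, v0, mcoeff1, eqxx, mul0r, subr0, mulr1).
Qed.

(* The coefficient of A_1^{la'_1} ... A_k^{la'_k}, after setting A_i = 0 for
   k < i <= 3. *)
Definition gf_coef (k : nat) (la : seq nat) : polyzJ :=
  let z : {mpoly polyzJ[k]} := ('X : polyzJ)%:MP in
  let J : {mpoly polyzJ[k]} := (('X : {poly int})%:P : polyzJ)%:MP in
  expansion (gf_num (gf_var k 1) (gf_var k 2) (gf_var k 3) z J)
            (gf_den (gf_var k 1) (gf_var k 2) (gf_var k 3) z J)
            [multinom part (conj_part la) i.+1 | i < k].

(* The coefficient of z^E J^(twoj/2) in z^a p(z, J); the exponents of z lie in
   C and those of J in (1/2)N. *)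
Definition shifted_coef (C : numClosedFieldType) (a : C) (p : polyzJ)
    (E : C) (twoj : nat) : int :=
  \sum_(b < size p | E == a + b%:R)
    \sum_(c < size p`_b | twoj == c.*2) p`_b`_c.

(* The equality of the generating function of the multiplicities m(E, j),
   j = twoj/2, with z^(|la|/2 + rstar) gf_coef k la, coefficient by
   coefficient. *)
Definition gf_identity (C : numClosedFieldType) (hbar omega : C) (la : seq nat)
    (V : gl_rep C 3) (k rstar : nat) : Prop :=
  forall (E : C) (twoj : nat),
    so_multiplicity (energy_space V hbar omega E) twoj.+1
      (shifted_coef ((sumn la)%:R / 2 + rstar%:R) (gf_coef k la) E twoj).

(* Main.v *)
Require Import Defs.
From HB Require Import structures.
From mathcomp Require Import all_boot all_order all_algebra.
From mathcomp.multinomials Require Import mpoly.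
From mathcomp Require Import ring lra zify.
From Stdlib Require Import Classical.

Set Implicit Arguments.
Unset Strict Implicit.
Unset Printing Implicit Defensive.

Import Order.TTheory GRing.Theory Num.Theory.
Local Open Scope ring_scope.

(** The image of V_lambda in a tensor power of C^{1|3} inherits the standard
    Hermitian form, for which e_{jk} and e_{kj} (j, k >= 1) are adjoint.  Hence
    every energy space is a direct sum of irreducible so(3)-modules, and by sl2
    theory the number of summands of dimension 2j+1 is the multiplicity of the
    weight j minus that of j+1, for the Cartan element i(e_{12} - e_{21}).  This
    element and e_{11} - e_{22} are both Cartan elements of the copy of sl2
    spanned by e_{11} - e_{22}, e_{12}, e_{21}, so the multiplicities can be read
    off from the differences mu_1 - mu_2 of the weights mu of gl(1|3).

    For a Schur function of shape m, Gelfand-Tsetlin patterns split these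
    differences into strings of length k1 - k2 + 1, one for each pair (k1, k2)
    with m1 >= k1 >= m2 >= k2 >= m3, and a string of d + 1 weights contributes
    (J^{d+1} + (-1)^d) / (J + 1).  Summing over m gives the rational function
    without the factors 1 + A_i z; those account for the vertical strips
    lambda' - nu' on the first three columns, and the other columns, which have
    one box each and are removed entirely, give z^{r*}. *)

(** * Eigenspaces and sl2-modules *)

(** The Cartan element of so(3) is not diagonal on weight vectors, so the character does not see it
    directly. The bridge is to decompose the same energy space twice: under so(3), where summands
    are counted, and under gl(2), where the two Cartan elements are compared. Dimensions of weight
    spaces do not depend on a decomposition, so the count is the same in every one, as
    [so_multiplicity] demands.

    A string meets only every second weight, so differences of consecutive weight multiplicities
    give alternating signs. A single string is therefore not an so(3)-character; sums are taken in
    [int], and only their total is a multiplicity. In the series the signs cancel through alt(d+1) +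
    alt(d) = J^(d+1), which is what the factors 1 - A1^2 and 1 - A1^2 A2^2 exploit. The rational
    function is never expanded: its denominator is multiplied onto the claimed coefficients one
    factor at a time, and uniqueness of the expansion concludes. *)

Section EigenDimensions.
Variables (F : fieldType) (vT : vectType F).
Implicit Types (A : 'End(vT)) (U W : {vspace vT}).

Lemma limg_subP A U W :
  reflect {in U, forall u, A u \in W} (A @: U <= W)%VS.
Proof.
apply: (iffP subvP) => [sAU u uU | AU _ /memv_imgP[u uU ->]].
  exact/sAU/memv_img.
exact: AU.
Qed.

Lemma mem_leigenspace A (c : F) v :
  (v \in passmx.leigenspace A c) = (A v == c *: v).
Proof.
by rewrite memv_ker add_lfunE opp_lfunE scale_lfunE id_lfunE subr_eq0.
Qed.

(* Peel off one root c at a time: U maps onto (A - c) U with kernel the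
   c-eigenspace, and the other eigenspaces of U survive in the image. *)
Lemma dim_eigen_split A (s : seq F) U :
  uniq s -> (A @: U <= U)%VS ->
  {in U, forall u, foldl (fun v c => A v - c *: v) u s = 0} ->
  \dim U = (\sum_(c <- s) \dim (U :&: passmx.leigenspace A c))%N.
Proof.
elim: s U => [|c s IH] U /=.
  move=> _ _ U0; rewrite big_nil; apply/eqP; rewrite dimv_eq0 -subv0.
  by apply/subvP => u /U0 ->; rewrite mem0v.
move=> /andP[cNs us] /limg_subP sU annU; rewrite big_cons.
set B := A - c *: \1%VF.
have BE u : B u = A u - c *: u by rewrite !lfun_simp.
rewrite -(limg_ker_dim B U); congr (_ + _)%N.
have sBU : {in U, forall u, B u \in U}.
  by move=> u uU; rewrite BE rpredB ?rpredZ ?sU.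
rewrite IH //; first 1 last.
- apply/limg_subP => _ /memv_imgP[u uU ->].
  suff -> : A (B u) = B (A u) by rewrite memv_img ?sU.
  by rewrite !BE linearB linearZ.
- by move=> _ /memv_imgP[u uU ->]; rewrite BE annU.
rewrite !big_seq; apply: eq_bigr => d ds; congr (\dim _).
have dc : d - c != 0 by rewrite subr_eq0; apply: contraNneq cNs => <-.
apply/vspaceP => v; rewrite !memv_cap !mem_leigenspace; apply: andb_id2r.
move=> /eqP Av; apply/idP/idP => [/memv_imgP[u uU ->]|vU]; first exact: sBU.
have -> : v = B ((d - c)^-1 *: v).
  by rewrite linearZ /= BE Av -scalerBl scalerA mulVf ?scale1r.
by rewrite memv_img ?rpredZ.
Qed.

(** The components x, y of a [c]-eigenvector in two stable summands satisfy (A - c) x = - (A - c) y,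
    which lies in the intersection of the summands and vanishes. Directness of the sum is encoded by
    the equality of dimensions. *)
Lemma dim_cap_eigen_sum A (c : F) (s : seq {vspace vT}) :
  \dim (\sum_(W <- s) W)%VS = (\sum_(W <- s) \dim W)%N ->
  {in s, forall W, (A @: W <= W)%VS} ->
  \dim ((\sum_(W <- s) W) :&: passmx.leigenspace A c)%VS =
  (\sum_(W <- s) \dim (W :&: passmx.leigenspace A c))%N.
Proof.
elim: s => [|W s IH]; first by rewrite !big_nil cap0v dimv0.
rewrite !big_cons => dimS stab; set K := passmx.leigenspace A c.
set S := (\sum_(W <- s) W)%VS in dimS IH *.
have leS : (\dim S <= \sum_(W <- s) \dim W)%N.
  rewrite /S; elim: (s) => [|W' s' IHs]; first by rewrite !big_nil dimv0.
  rewrite !big_cons; apply: leq_trans (leq_add (leqnn _) IHs).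
  by rewrite -dimv_sum_cap leq_addr.
have eS := dimv_sum_cap W S.
have WS0 : (W :&: S = 0)%VS.
  apply/eqP; rewrite -dimv_eq0 -leqn0 -(leq_add2l (\dim (W + S))) eS addn0.
  by rewrite dimS leq_add2l.
have dS : \dim S = (\sum_(W <- s) \dim W)%N.
  by apply/eqP; rewrite -(eqn_add2l (\dim W)) -dimS -eS WS0 dimv0 addn0.
have stabs : {in s, forall W, (A @: W <= W)%VS}.
  by move=> X Xs; apply: stab; rewrite in_cons Xs orbT.
rewrite -(IH dS stabs) -dimv_disjoint_sum; last first.
  by apply/eqP; rewrite -subv0 -WS0 capvS ?capvSl.
congr (\dim _); apply/vspaceP => v; apply/idP/idP; last first.
  move=> /memv_addP[x /memv_capP[xW xK] [y /memv_capP[yS yK] ->]].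
  by rewrite memv_cap memv_add ?memvD.
case/memv_capP=> /memv_addP[x xW [y yS ->]] xyK.
have sW : {in W, forall u, A u \in W}.
  by apply/limg_subP/stab; rewrite in_cons eqxx.
have sS : {in S, forall u, A u \in S}.
  apply/limg_subP; rewrite /S limg_sum big_seq [X in (_ <= X)%VS]big_seq.
  by apply: (big_ind2 (fun X Y => (X <= Y)%VS)) => [|X Y X' Y'|X /stabs //];
     [rewrite sub0v | exact: addvS].
have eq0 : A x - c *: x = - (A y - c *: y).
  move: xyK; rewrite mem_leigenspace linearD scalerDr => /eqP e.
  by apply/eqP; rewrite -subr_eq0 opprK addrACA e -opprD subrr.
have x0 : A x - c *: x = 0.
  apply/eqP; rewrite -memv0 -WS0 memv_cap.
  by rewrite {2}eq0 rpredN !rpredB ?rpredZ ?sW ?sS.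
have y0 : A y - c *: y = 0 by apply/eqP; rewrite -oppr_eq0 -eq0 x0.
by rewrite memv_add // memv_cap mem_leigenspace -subr_eq0 ?x0 ?y0 eqxx
  ?xW ?yS.
Qed.

Lemma eigenvectors_free A (s : seq vT) (c : vT -> F) :
  {in s, forall v, v != 0 /\ A v = c v *: v} -> uniq (map c s) -> free s.
Proof.
elim: s => [|v s IH]; first by rewrite nil_free.
move=> As /= /andP[cNs us]; rewrite free_cons IH ?andbT //; last first.
  by move=> w ws; apply: As; rewrite in_cons ws orbT.
apply/negP => vs; have [vn0 Av] := As v (mem_head _ _).
have fr : free s by apply: IH => // w ws; apply: As; rewrite in_cons ws orbT.
have := free_span fr vs => -[k vE kU].
have Aw : {in s, forall w, A w = c w *: w}.
  by move=> w ws; case: (As w) => //; rewrite in_cons ws orbT.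
suff k0 : {in s, k =1 fun=> 0}.
  move/eqP: vn0; apply; rewrite vE big_seq big1 // => w ws.
  by rewrite k0 // scale0r.
move=> w ws; have e0 : \sum_(w <- s) (k w * (c w - c v)) *: w = 0.
  have: A v - c v *: v = 0 by rewrite Av subrr.
  rewrite {1 3}vE linear_sum scaler_sumr -sumrB; apply: etrans.
  rewrite big_seq [RHS]big_seq; apply: eq_bigr => x xs.
  by rewrite linearZ /= Aw // !scalerA -scalerBl mulrBr [c v * _]mulrC.
have cw : c w - c v != 0.
  by rewrite subr_eq0; apply: contraNneq cNs => <-; rewrite map_f.
have: k w * (c w - c v) = 0.
  have [k0 _ kU0] := free_span fr (mem0v _).
  have := kU0 _ (esym e0) w ws => ->.
  have := kU0 (fun=> 0) _ w ws; rewrite big1 => [-> //|i _].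
  by rewrite scale0r.
by move/eqP; rewrite mulf_eq0 (negPf cw) orbF => /eqP.
Qed.

End EigenDimensions.

Lemma exists_eigenvector (F : closedFieldType) (vT : vectType F)
    (A : 'End(vT)) (W : {vspace vT}) :
  W != 0%VS -> (A @: W <= W)%VS ->
  exists2 v, v != 0 & exists c : F, A v = c *: v /\ v \in W.
Proof.
move=> W0 /limg_subP sW.
have g_lin : linear (fun u : subvs_of W => vsproj W (A (vsval u))).
  by move=> a u v; rewrite !linearP.
pose g := GRing.isLinear.Build _ _ _ _ _ g_lin.
pose gl : {linear _ -> _} := HB.pack (fun u => vsproj W (A (vsval u))) g.
pose B : 'End(subvs_of W) := linfun gl.
have BE u : vsval (B u) = A (vsval u) by rewrite lfunE /= vsprojK ?sW ?subvsP.
have e_b := vbasisP {:subvs_of W}.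
set e := vbasis {:subvs_of W} in e_b.
set M := passmx.mxof e e B.
have d0 : (0 < \dim {:subvs_of W})%N by rewrite dimvf /= lt0n dimv_eq0.
have [c /eqP rc] : exists c, root (char_poly M) c.
  by apply/closed_rootP; rewrite size_char_poly; case: (\dim _) d0.
have: eigenvalue M c by rewrite eigenvalue_root_char; apply/eqP.
rewrite /eigenvalue -(passmx.vsof_eq0 e_b) -passmx.leigenspaceE // => nz.
exists (vsval (vpick (passmx.leigenspace B c))).
  apply: contraNneq nz => e0; rewrite -vpick0; apply/eqP/val_inj.
  have v0 : vsval (0 : subvs_of W) = 0 by rewrite raddf0.
  exact: etrans e0 (esym v0).
exists c; split; last exact: subvsP.
have := memv_pick (passmx.leigenspace B c).
by rewrite mem_leigenspace -BE => /eqP ->; rewrite linearZ.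
Qed.

(** [P] is a stability predicate, so that one theory covers so(3) and gl(2). *)
Definition irreducible_for (F : fieldType) (vT : vectType F)
    (P : {vspace vT} -> Prop) (W : {vspace vT}) : Prop :=
  [/\ P W, W != 0%VS &
      forall U : {vspace vT}, (U <= W)%VS -> P U -> U = 0%VS \/ U = W].

Lemma indexed_eigenvectors_free (F : fieldType) (vT : vectType F)
    (A : 'End(vT)) (u : nat -> vT) (c : nat -> F) (s : seq nat) :
  {in s, forall i, u i != 0 /\ A (u i) = c i *: u i} -> uniq (map c s) ->
  free (map u s).
Proof.
move=> Au us; pose c' v := c (nth 0%N s (index v (map u s))).
have c'E : {in s, forall i, c' (u i) = c i}.
  move=> i si; set j := nth 0%N s (index (u i) (map u s)).
  have lt_idx : (index (u i) (map u s) < size s)%N.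
    by rewrite -(size_map u) index_mem map_f.
  have uj : u j = u i by rewrite -(nth_map _ 0) // nth_index // map_f.
  have js : j \in s by apply: mem_nth.
  have [ui0 hi] := Au i si; have [_ hj] := Au j js.
  have : (c j - c i) *: u i = 0 by rewrite scalerBl -{1}uj -hj uj hi subrr.
  by move/eqP; rewrite scaler_eq0 (negPf ui0) orbF subr_eq0 => /eqP.
apply: (@eigenvectors_free _ _ A _ c').
  by move=> _ /mapP[i si ->]; rewrite c'E //; apply: Au.
rewrite -map_comp; suff -> : map (c' \o u) s = map c s by [].
exact/eq_in_map.
Qed.

Lemma dim_line_eigen (F : fieldType) (vT : vectType F) (A : 'End(vT))
    (w : vT) (a c : F) :
  w != 0 -> A w = a *: w ->
  \dim (<[w]> :&: passmx.leigenspace A c)%VS = (c == a).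
Proof.
move=> w0 Aw; case: eqVneq => [->|ca].
  have -> : (<[w]> :&: passmx.leigenspace A a = <[w]>)%VS.
    by apply/capv_idPl; rewrite -memvE mem_leigenspace Aw.
  by rewrite dim_vline w0.
apply/eqP; rewrite dimv_eq0 -subv0; apply/subvP => v.
case/memv_capP=> /vlineP[k ->]; rewrite mem_leigenspace linearZ /= Aw.
rewrite !scalerA -subr_eq0 -scalerBl scaler_eq0 (negPf w0) orbF.
rewrite mulrC -mulrBl mulf_eq0 subr_eq0 eq_sym (negPf ca) /= => /eqP ->.
by rewrite scale0r mem0v.
Qed.

(** * Irreducible modules of sl2 *)

Section Sl2.
Variables (C : numClosedFieldType) (vT : vectType C).
Implicit Types (h e f : 'End(vT)) (U W : {vspace vT}).

Definition sl2_triple h e f : Prop :=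
  [/\ forall v, h (e v) = e (h v) + 2 *: e v,
      forall v, h (f v) = f (h v) - 2 *: f v &
      forall v, e (f v) = f (e v) + h v].

(** Nonzero vectors of the ladder belong to distinct eigenvalues, since [a] is nonzero; [\dim W] + 1
    of them would be free in [W]. *)
Lemma eigen_ladder_stops h W (u : nat -> vT) (c a : C) :
  a != 0 -> (forall k, u k \in W) ->
  (forall k, h (u k) = (c + a * k%:R) *: u k) ->
  exists k, u k == 0.
Proof.
move=> a0 uW hu; set d := \dim W.
case: (boolP [exists k : 'I_d.+1, u k == 0]) => [/existsP[k]|/existsPn nz].
  by exists k.
have fr : free (map u (iota 0 d.+1)).
  apply: (@indexed_eigenvectors_free _ _ h _ (fun k => c + a * k%:R)).
    move=> k; rewrite mem_iota /= => kd; split => //.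
    exact: (nz (Ordinal kd)).
  rewrite map_inj_uniq ?iota_uniq // => i j /addrI /(mulfI a0) /eqP.
  by rewrite eqr_nat => /eqP.
have: (<<map u (iota 0 d.+1)>> <= W)%VS.
  by apply/span_subvP => _ /mapP[k _ ->].
move/dimvS; have /eqP -> : \dim <<map u (iota 0 d.+1)>> == d.+1.
  by move: fr; rewrite /free size_map size_iota.
by rewrite ltnn.
Qed.

(** Highest weight theory: [W] has the basis w, f w, ..., f^K w below a highest weight vector w,
    whose weight is K = [\dim W] - 1, so each weight K - 2k occurs once. *)
Lemma sl2_irreducible_weights h e f (P : {vspace vT} -> Prop) W (c : C) :
  sl2_triple h e f ->
  (forall U, P U <-> [/\ (h @: U <= U)%VS, (e @: U <= U)%VS
                       & (f @: U <= U)%VS]) ->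
  irreducible_for P W ->
  \dim (W :&: passmx.leigenspace h c)%VS =
  [exists k : 'I_(\dim W), c == (\dim W)%:R - 1 - 2 * k%:R].
Proof.
move=> [he hf ef] PE [/PE[hW eW fW] W0 irrW].
have [v v0 [c0 [hv vW]]] := exists_eigenvector W0 hW.
move/limg_subP in hW; move/limg_subP in eW; move/limg_subP in fW.
have two0 : (2 : C) != 0 by rewrite pnatr_eq0.
(* The last nonzero vector among the e^k v is a highest weight vector. *)
have [w [w0 wW [a [hw ew]]]] :
    exists w, [/\ w != 0, w \in W & exists a, h w = a *: w /\ e w = 0].
  pose u k := iter k e v.
  have uW k : u k \in W by elim: k => //= k IH; apply: eW.
  have hu k : h (u k) = (c0 + 2 * k%:R) *: u k.
    elim: k => [|k IH] /=; first by rewrite mulr0 addr0.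
    rewrite he IH linearZ /= -scalerDl; congr (_ *: _); rewrite -natr1; ring.
  have uex := eigen_ladder_stops two0 uW hu.
  case: (ex_minnP uex) => -[|k] uk0 kmin; first by rewrite uk0 in v0.
  exists (u k); split=> //; first by apply/negP => /kmin; rewrite ltnn.
  by exists (c0 + 2 * k%:R); split; [exact: hu | exact/eqP].
pose u k := iter k f w.
have uS k : u k.+1 = f (u k) by [].
have u0 : u 0%N = w by [].
clearbody u.
have uW k : u k \in W by elim: k => [|k IH]; rewrite ?u0 // uS; apply: fW.
have hu k : h (u k) = (a - 2 * k%:R) *: u k.
  elim: k => [|k IH]; first by rewrite u0 mulr0 subr0.
  rewrite uS hf IH linearZ /= -scalerBl; congr (_ *: _); rewrite -natr1; ring.
have eu k : e (u k.+1) = (k.+1%:R * (a - k%:R)) *: u k.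
  elim: k => [|k IH]; first by rewrite uS u0 ef ew linear0 add0r mul1r subr0.
  rewrite [u k.+2]uS ef IH linearZ /= -uS hu -scalerDl.
  congr (_ *: _); rewrite -!natr1; ring.
have hu' k : h (u k) = (a + (- 2) * k%:R) *: u k by rewrite mulNr hu.
have mtwo0 : - 2 != 0 :> C by rewrite oppr_eq0.
have uex := eigen_ladder_stops mtwo0 uW hu'.
case: (ex_minnP uex) => -[|K] /eqP uK0 Kmin; first by rewrite -u0 uK0 eqxx in w0.
have unz k : (k <= K)%N -> u k != 0.
  by move=> kK; apply/negP => /Kmin; rewrite leqNgt ltnS kK.
(* At the end of the ladder, 0 = e (u (K+1)) = (K+1) (a - K) u K. *)
have aK : a = K%:R.
  have := eu K; rewrite uK0 linear0 => /esym/eqP.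
  by rewrite scaler_eq0 (negPf (unz K _)) // orbF mulf_eq0 pnatr_eq0 /= subr_eq0
    => /eqP.
pose s := map u (iota 0 K.+1).
have us k : (k <= K)%N -> u k \in <<s>>%VS.
  by move=> kK; rewrite memv_span ?map_f ?mem_iota.
have stab (A : 'End(vT)) : (forall k, (k <= K)%N -> A (u k) \in <<s>>%VS) ->
    (A @: <<s>> <= <<s>>)%VS.
  move=> Au; rewrite limg_span; apply/span_subvP => _ /mapP[_ /mapP[k] + -> ->].
  by rewrite mem_iota ltnS; apply: Au.
have sW : <<s>>%VS = W.
  have sub : (<<s>> <= W)%VS by apply/span_subvP => _ /mapP[k _ ->].
  case: (irrW _ sub) => // [|s0]; last first.
    by move: (us 0%N (leq0n K)); rewrite s0 memv0 (negPf (unz 0%N _)).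
  apply/PE; split; apply: stab => k kK.
  - by rewrite hu rpredZ ?us.
  - case: k kK => [|k] kK; first by rewrite u0 ew mem0v.
    by rewrite eu rpredZ ?us // ltnW.
  - rewrite -uS; case: (ltngtP k K) kK => // [kK _|-> _].
      exact: us.
    by rewrite uK0 mem0v.
have w2 k : 2 * (k%:R : C) = (2 * k)%:R by rewrite natrM.
have inj2 i j : a - 2 * i%:R = a - 2 * j%:R -> i = j.
  by move/addrI/oppr_inj/(mulfI two0)/eqP; rewrite eqr_nat => /eqP.
have fr : free s.
  apply: (@indexed_eigenvectors_free _ _ h _ (fun k => a - 2 * k%:R)).
    by move=> k; rewrite mem_iota ltnS /= => kK; split; [apply: unz|apply: hu].
  by rewrite map_inj_uniq ?iota_uniq //; exact: inj2.
have dW : \dim W = K.+1.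
  by rewrite -sW; apply/eqP; move: fr; rewrite /free size_map size_iota.
pose L := [seq <[u k]>%VS | k <- iota 0 K.+1].
have dL : (\sum_(k <- iota 0 K.+1) (\dim <[u k]>)%VS = K.+1)%N.
  rewrite big_seq (eq_bigr (fun=> 1%N)) -?big_seq ?sum1_size ?size_iota //.
  by move=> k; rewrite mem_iota ltnS dim_vline => kK; rewrite unz.
have WL : (\sum_(X <- L) X)%VS = W by rewrite big_map -sW span_def big_map.
rewrite -{1}WL dim_cap_eigen_sum; first 1 last.
- by rewrite WL big_map dW dL.
- move=> _ /mapP[k _ ->]; rewrite limg_line -memvE hu; apply/vlineP.
  by exists (a - 2 * k%:R).
rewrite big_map big_seq.
rewrite (eq_bigr (fun k => (c == a - 2 * k%:R) : nat)) -?big_seq; last first.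
  by move=> k; rewrite mem_iota ltnS => kK; apply: dim_line_eigen; rewrite ?unz.
rewrite dW aK -[K.+1%:R]natr1 addrK -[iota 0 K.+1]/(index_iota 0 K.+1) big_mkord.
case: existsP => [[k ck]|nk]; last first.
  rewrite big1 // => k _; apply/eqP; rewrite eqb0; apply/negP => ck.
  by case: nk; exists k.
rewrite (bigD1 k) //= ck big1 // => i /negP ik; apply/eqP; rewrite eqb0.
apply/negP => ci; apply: ik; apply/eqP/val_inj/inj2 => /=.
by rewrite aK -(eqP ci) (eqP ck).
Qed.
End Sl2.

(** * Complete reducibility *)

Section SemisimpleDecomposition.
Variables (F : fieldType) (vT : vectType F) (P : {vspace vT} -> Prop).

Definition irreducible_decomposition (U : {vspace vT})
    (s : seq {vspace vT}) : Prop :=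
  [/\ (\sum_(W <- s) W)%VS = U, \dim U = (\sum_(W <- s) \dim W)%N &
      {in s, forall W, irreducible_for P W}].

Hypothesis complement : forall U W : {vspace vT}, P U -> P W -> (U <= W)%VS ->
  exists U', [/\ P U', (U :&: U' = 0)%VS & (U + U' = W)%VS].

Lemma irreducible_decomposition_exists W :
  P W -> exists s, irreducible_decomposition W s.
Proof.
have [d] := ubnP (\dim W); elim: d W => // d IH W ltWd PW.
have [->|W0] := eqVneq W 0%VS.
  by exists [::]; split=> //; rewrite !big_nil ?dimv0.
(* Irreducibility quantifies over all subspaces, so the case distinction is classical. *)
have [irrW|] := classic (irreducible_for P W).
  exists [:: W]; split; rewrite ?big_seq1 // => X.
  by rewrite inE => /eqP ->.
move=> nirr; have [U [UW PU U0 UnW]] :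
    exists U, [/\ (U <= W)%VS, P U, U != 0%VS & U != W].
  apply: NNPP => no; apply: nirr; split=> // U UW PU.
  have [->|U0] := eqVneq U 0%VS; first by left.
  have [->|UnW] := eqVneq U W; first by right.
  by case: no; exists U.
have [U' [PU' UU'0 UU'W]] := complement PU PW UW.
have dW : (\dim U + \dim U' = \dim W)%N by rewrite -dimv_disjoint_sum // UU'W.
have ltU : (\dim U < \dim W)%N.
  by rewrite ltn_neqAle (dimv_leqif_eq UW) UnW dimvS.
have U'lt : (\dim U' < \dim W)%N.
  by rewrite -dW -[X in (X < _)%N]add0n ltn_add2r lt0n dimv_eq0.
have [s [sU ds irs]] := IH U (leq_trans ltU ltWd) PU.
have [s' [sU' ds' irs']] := IH U' (leq_trans U'lt ltWd) PU'.
exists (s ++ s'); split; rewrite ?big_cat /= ?sU ?sU' //.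
  by rewrite -dW ds ds'.
by move=> X; rewrite mem_cat => /orP[/irs|/irs'].
Qed.

End SemisimpleDecomposition.

Section OrthogonalComplement.
Variables (F : fieldType) (vT : vectType F) (B : vT -> 'Hom(vT, F^o)).
Hypothesis B_sym0 : forall u v, B u v = 0 -> B v u = 0.
Hypothesis B_def : forall u, B u u = 0 -> u = 0.

(** Each linear form takes away at most one dimension. *)
Lemma dim_cap_kernels (r : seq vT) (W : {vspace vT}) :
  (\dim W <= \dim (W :&: \bigcap_(b <- r) lker (B b)) + size r)%N.
Proof.
elim: r W => [|b r IH] W; first by rewrite big_nil capvf addn0.
rewrite big_cons capvA /= addnS -addSn.
apply: leq_trans (_ : _ <= (\dim (W :&: lker (B b))).+1)%N _.
  rewrite -(limg_ker_dim (B b) W) -addn1 leq_add2l.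
  by apply: leq_trans (dimvS (subvf _)) _; rewrite dimvf.
by rewrite addSn ltnS.
Qed.

Variables (I : Type) (ops : I -> 'End(vT)).
Hypothesis adjoint : forall i, exists j, forall u v,
  B u (ops i v) = B (ops j u) v.

(** The orthogonal of [U] in [W] is stable because the family of operators contains adjoints,
    disjoint from [U] because no nonzero vector is isotropic, and large enough because [\dim U]
    linear forms cut it out. [B] is linear in its second argument only; the symmetry of
    orthogonality makes up for the first. *)
Lemma orthogonal_complement (U W : {vspace vT}) :
  (forall i, (ops i @: U <= U)%VS) -> (forall i, (ops i @: W <= W)%VS) ->
  (U <= W)%VS ->
  exists U', [/\ forall i, (ops i @: U' <= U')%VS, (U :&: U' = 0)%VS
               & (U + U' = W)%VS].
Proof.
move=> sU sW UW; set K := (\bigcap_(b <- vbasis U) lker (B b))%VS.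
have KE v : (v \in K) = all (fun b => B b v == 0) (vbasis U).
  rewrite /K; elim: (tval _) => [|b r IH]; first by rewrite big_nil memvf.
  by rewrite big_cons memv_cap IH memv_ker.
have KP v : reflect {in U, forall u, B u v = 0} (v \in K).
  rewrite KE; apply: (iffP allP) => [Bv u uU|Bv b /vbasis_mem bU]; last first.
    exact/eqP/Bv.
  apply: B_sym0; apply/eqP; rewrite -memv_ker.
  suff /subvP/(_ u uU) : (U <= lker (B v))%VS by [].
  rewrite -(span_basis (vbasisP U)); apply/span_subvP => b /Bv /eqP b0.
  by rewrite memv_ker B_sym0.
have U0 : (U :&: (W :&: K) = 0)%VS.
  apply/eqP; rewrite -subv0; apply/subvP => u /memv_capP[uU /memv_capP[_]].
  by move=> /KP/(_ u uU)/B_def ->; rewrite mem0v.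
exists (W :&: K)%VS; split=> //.
  move=> i; apply/limg_subP => v /memv_capP[vW /KP vK]; rewrite memv_cap.
  have /limg_subP -> // := sW i; apply/KP => u uU.
  by have [j ->] := adjoint i; apply: vK; have /limg_subP := sU j; apply.
apply/eqP; rewrite eqEdim subv_add UW capvSl /=.
rewrite dimv_disjoint_sum // addnC.
by have := dim_cap_kernels (vbasis U) W; rewrite size_tuple.
Qed.
End OrthogonalComplement.

Section Sl2Multiplicities.
Variables (C : numClosedFieldType) (vT : vectType C).
Variables (P : {vspace vT} -> Prop) (h e f : 'End(vT)).
Hypothesis hef : sl2_triple h e f.
Hypothesis PE : forall U, P U <->
  [/\ (h @: U <= U)%VS, (e @: U <= U)%VS & (f @: U <= U)%VS].

Lemma sl2_weights_decomposition U s (c : C) :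
  irreducible_decomposition P U s ->
  \dim (U :&: passmx.leigenspace h c)%VS =
  (\sum_(W <- s)
     [exists k : 'I_(\dim W), (c == (\dim W)%:R - 1 - 2 * k%:R)%R])%N.
Proof.
move=> [sU ds irs]; rewrite -{1}sU dim_cap_eigen_sum ?sU //; last first.
  by move=> W /irs[/PE[]].
rewrite big_seq [RHS]big_seq; apply: eq_bigr => W Ws.
exact: sl2_irreducible_weights hef PE (irs W Ws).
Qed.

(** A summand of dimension d + 1 has the weight t exactly when t <= d and t = d mod 2. It then has
    the weight t + 2 as well, unless d = t. *)
Lemma sl2_multiplicity U s (t : nat) :
  irreducible_decomposition P U s ->
  \dim (U :&: passmx.leigenspace h t%:R)%VS =
  (\dim (U :&: passmx.leigenspace h t.+2%:R)%VS +
   count (fun W => \dim W == t.+1) s)%N.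
Proof.
move=> dec; rewrite !(sl2_weights_decomposition _ dec).
rewrite -sum1_count [X in (_ + X)%N]big_mkcond -big_split /=.
case: dec => _ _ irs; rewrite big_seq [RHS]big_seq; apply: eq_bigr => W Ws.
have [_ W0 _] := irs W Ws.
have : (0 < \dim W)%N by rewrite lt0n dimv_eq0.
case: (\dim W) => // d _.
have wE u : [exists k : 'I_d.+1, u%:R == d.+1%:R - 1 - 2 * k%:R :> C] =
    (u <= d)%N && (odd u == odd d).
  apply/existsP/andP => [[k]|[ud /eqP uod]].
    rewrite -[d.+1%:R]natr1 addrK eq_sym subr_eq -natrM -natrD eqr_nat => /eqP dE.
    split; lia.
  have kd : ((d - u)./2 < d.+1)%N by lia.
  exists (Ordinal kd); rewrite -[d.+1%:R]natr1 addrK eq_sym subr_eq -natrM.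
  rewrite -natrD eqr_nat /=; lia.
rewrite !wE eqSS /= negbK; have [->|dt] := eqVneq d t.
  by rewrite leqnn eqxx ltnNge leqnSn.
case: eqP => odd_td; rewrite ?andbF // !andbT addn0; congr nat_of_bool; lia.
Qed.

End Sl2Multiplicities.

(** * The subalgebras so(3) and gl(2) of u(3) *)

(** Reduces identities between vectors to identities in the field, where [ring] applies. *)
Lemma coord_ext (F : fieldType) (vT : vectType F) (u v : vT) :
  (forall i, coord (vbasis {:vT}) i u = coord (vbasis {:vT}) i v) -> u = v.
Proof.
move=> uv; rewrite (coord_vbasis (memvf u)) (coord_vbasis (memvf v)).
by apply: eq_bigr => i _; rewrite uv.
Qed.

Lemma lfun_linE (F : fieldType) (vT : vectType F) (g : 'End(vT)) :
  (forall u v, g (u + v) = g u + g v) * (forall u, g (- u) = - g u) *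
  (forall a u, g (a *: u) = a *: g u).
Proof. by split=> [|a u]; [split=> *; [exact: linearD|exact: linearN]|exact: linearZ]. Qed.

Lemma coord_linE (F : fieldType) (vT : vectType F) i
    (c := coord (vbasis {:vT}) i) :
  (forall u v, c (u + v) = c u + c v) * (forall u, c (- u) = - c u) *
  (forall a u, c (a *: u) = a * c u).
Proof.
by split=> [|a u]; [split=> *; [exact: linearD|exact: linearN]|exact: linearZ].
Qed.

Section Sl2Variants.
Variables (C : numClosedFieldType) (vT : vectType C).
Implicit Types h e f : 'End(vT).

(* The Pauli matrices permuted cyclically. *)
Lemma sl2_triple_rotated h e f :
  sl2_triple h e f ->
  sl2_triple ('i *: (e - f)) (e + f + 'i *: h) (4^-1 *: (e + f - 'i *: h)).
Proof.
move=> [he hf ef]; have ii : ('i : C) * 'i = -1 by rewrite -expr2 sqrCi.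
have q4 : (4 : C)^-1 * 4 = 1 by rewrite mulVf ?pnatr_eq0.
pose gE := (lfun_linE h, lfun_linE e, lfun_linE f).
split=> v; rewrite !lfun_simp; apply: coord_ext => n;
  rewrite ?gE ?he ?hf ?ef ?coord_linE.
all: move: ('i : C) (4^-1 : C) ii q4 => i q ii q4;
  set c := coord _ _;
  move: (c (e (e v))) (c (f (f v))) (c (h (h v))) (c (f (e v))) (c (e (h v)))
    (c (f (h v))) (c (h v)) (c (e v)) (c (f v)) => z1 z2 z3 z4 z5 z6 z7 z8 z9.
- ring: ii.
- ring: ii.
- have -> : i * (z8 - z9) = q * 4 * (i * (z8 - z9)) by rewrite q4 mul1r.
  ring: ii.
Qed.

(** The factor 2 turns the spin, an eigenvalue of ['i *: X], into a weight of the sl2-triple. *)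
Lemma sl2_triple_of_so3 (X Y Z : 'End(vT)) :
  (forall v, X (Y v) = Y (X v) + Z v) ->
  (forall v, Y (Z v) = Z (Y v) + X v) ->
  (forall v, Z (X v) = X (Z v) + Y v) ->
  sl2_triple ((2 * 'i) *: X) (Y + 'i *: Z) (- Y + 'i *: Z).
Proof.
move=> XY YZ ZX; have ii : ('i : C) * 'i = -1 by rewrite -expr2 sqrCi.
pose gE := (lfun_linE X, lfun_linE Y, lfun_linE Z).
split=> v; rewrite !lfun_simp; apply: coord_ext => n;
  rewrite ?gE ?XY ?YZ ?ZX ?coord_linE.
all: move: ('i : C) ii => i ii;
  set c := coord _ _;
  move: (c (Y (X v))) (c (Z (Y v))) (c (X (Z v))) (c (X v)) (c (Y v)) (c (Z v))
  (c (Y (Y v))) (c (Z (Z v)))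
   => z1 z2 z3 z4 z5 z6 z7 z8.
- ring: ii.
- ring: ii.
- ring: ii.
Qed.
End Sl2Variants.

Section SpanStability.
Variables (C : numClosedFieldType) (vT : vectType C).
Implicit Types (U : {vspace vT}) (A B : 'End(vT)).

Lemma memv_addsub U u v : u + v \in U -> u - v \in U -> u \in U /\ v \in U.
Proof.
move=> uv1 uv2; have two0 : (2 : C) != 0 by rewrite pnatr_eq0.
have uU : u \in U.
  have -> : u = 2^-1 *: ((u + v) + (u - v)).
    by rewrite addrACA subrr addr0 -mulr2n -scaler_nat scalerA mulVf ?scale1r.
  exact/rpredZ/rpredD.
by split=> //; rewrite -(rpredDr _ uU) addrC.
Qed.

Lemma memvZ_eq U (a : C) u : a != 0 -> (a *: u \in U) = (u \in U).
Proof.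
move=> a0; apply/idP/idP => [auU|]; last exact: rpredZ.
by rewrite -[u]scale1r -(mulVf a0) -scalerA rpredZ.
Qed.

Lemma limg_sub_addsub A B U : ((A + B) @: U <= U)%VS -> ((A - B) @: U <= U)%VS ->
  (A @: U <= U)%VS /\ (B @: U <= U)%VS.
Proof.
move=> /limg_subP sD /limg_subP sB; split; apply/limg_subP => u uU;
  have := sD u uU; have := sB u uU; rewrite !lfun_simp => m1 m2;
  by have [] := memv_addsub m2 m1.
Qed.

Lemma limg_subZ_eq (a : C) A U :
  a != 0 -> ((a *: A) @: U <= U)%VS <-> (A @: U <= U)%VS.
Proof.
move=> a0; split=> /limg_subP sA; apply/limg_subP => u /sA;
  by rewrite scale_lfunE memvZ_eq.
Qed.

Lemma limg_subD A B U : (A @: U <= U)%VS -> (B @: U <= U)%VS ->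
  ((A + B) @: U <= U)%VS.
Proof.
move=> /limg_subP sA /limg_subP sB; apply/limg_subP => u uU.
by rewrite add_lfunE rpredD ?sA ?sB.
Qed.

Lemma limg_subN A U : (A @: U <= U)%VS <-> ((- A) @: U <= U)%VS.
Proof.
by split=> /limg_subP sA; apply/limg_subP => u /sA; rewrite opp_lfunE rpredN.
Qed.

Lemma limg_subB A B U : (A @: U <= U)%VS -> (B @: U <= U)%VS ->
  ((A - B) @: U <= U)%VS.
Proof. by move=> sA /limg_subN sB; apply: limg_subD. Qed.

End SpanStability.

Section Gl3.
Variables (C : numClosedFieldType) (vT : vectType C).
Variable x : 'I_3 -> 'I_3 -> 'End(vT).
Hypothesis x_bracket : forall i j k l v,
  x i j (x k l v) =
  x k l (x i j v) + (j == k)%:R *: x i l v - (i == l)%:R *: x k j v.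

Let i0 : 'I_3 := ord0.
Let i1 : 'I_3 := lift ord0 ord0.
Let i2 : 'I_3 := ord_max.

Definition gl_H := x ord0 ord0 - x (lift ord0 ord0) (lift ord0 ord0).

Definition gl2_stable (U : {vspace vT}) : Prop :=
  [/\ (gl_H @: U <= U)%VS, (x i0 i1 @: U <= U)%VS & (x i1 i0 @: U <= U)%VS].

Definition antisym_stable (U : {vspace vT}) : Prop :=
  forall j k, ((x j k - x k j) @: U <= U)%VS.

Let X := x i0 i1 - x i1 i0.
Let Y := x i1 i2 - x i2 i1.
Let Z := x i0 i2 - x i2 i0.

Lemma gl2_triple : sl2_triple gl_H (x i0 i1) (x i1 i0).
Proof.
split=> v; rewrite /gl_H -/i0 -/i1 !lfun_simp.
- rewrite (x_bracket i0 i0 i0 i1) (x_bracket i1 i1 i0 i1) /=.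
  by apply: coord_ext => i; rewrite !lfun_linE !coord_linE; ring.
- rewrite (x_bracket i0 i0 i1 i0) (x_bracket i1 i1 i1 i0) /=.
  by apply: coord_ext => i; rewrite !lfun_linE !coord_linE; ring.
- rewrite (x_bracket i0 i1 i1 i0) /=.
  by apply: coord_ext => i; rewrite !coord_linE; ring.
Qed.

Lemma antisym_bracket :
  [/\ forall v, X (Y v) = Y (X v) + Z v,
      forall v, Y (Z v) = Z (Y v) + X v &
      forall v, Z (X v) = X (Z v) + Y v].
Proof.
split=> v; rewrite /X /Y /Z !lfun_simp !lfun_linE.
- rewrite !(x_bracket i0 i1 _ _ v) !(x_bracket i1 i0 _ _ v) /=.
  by apply: coord_ext => i; rewrite !coord_linE; ring.
- rewrite !(x_bracket i1 i2 _ _ v) !(x_bracket i2 i1 _ _ v) /=.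
  by apply: coord_ext => i; rewrite !coord_linE; ring.
- rewrite !(x_bracket i0 i2 _ _ v) !(x_bracket i2 i0 _ _ v) /=.
  by apply: coord_ext => i; rewrite !coord_linE; ring.
Qed.

Let i_neq0 : ('i : C) != 0. Proof. exact: neq0Ci. Qed.

(** Puts so(3)-stability in the form that the sl2 results require: invariance under the three
    members of one triple. *)
Lemma antisym_stableE U :
  antisym_stable U <->
  [/\ (((2 * 'i) *: X) @: U <= U)%VS, ((Y + 'i *: Z) @: U <= U)%VS
    & ((- Y + 'i *: Z) @: U <= U)%VS].
Proof.
have ti : 2 * 'i != 0 :> C by rewrite mulf_neq0 ?pnatr_eq0.
split=> [sU | [/(limg_subZ_eq _ _ ti) sX sYZ sYZ']].
  have [sX sY sZ] : [/\ (X @: U <= U)%VS, (Y @: U <= U)%VS & (Z @: U <= U)%VS].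
    by split; apply: sU.
  split; first exact/limg_subZ_eq.
    by apply: limg_subD => //; apply/limg_subZ_eq.
  by apply: limg_subD; [apply/limg_subN; rewrite opprK | apply/limg_subZ_eq].
have sYZ'' : ((Y - 'i *: Z) @: U <= U)%VS.
  by apply/limg_subN; rewrite opprB addrC.
have [sY /(limg_subZ_eq _ _ i_neq0) sZ] := limg_sub_addsub sYZ sYZ''.
have flip j k : ((x j k - x k j) @: U <= U)%VS -> ((x k j - x j k) @: U <= U)%VS.
  by move=> /limg_subN; rewrite opprB.
have diag j : ((x j j - x j j) @: U <= U)%VS by rewrite subrr lim0g sub0v.
have caseI (j : 'I_3) : [\/ j = i0, j = i1 | j = i2].
  by case: j => -[|[|[|//]]] jlt; [apply: Or31|apply: Or32|apply: Or33];
    apply: val_inj.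
by move=> j k; case: (caseI j) => ->; case: (caseI k) => -> //; apply: flip.
Qed.

(** The rotated triple spans the same sl2 as [gl_H], [x i0 i1], [x i1 i0], so one decomposition
    serves both triples. *)
Lemma gl2_stableE U :
  gl2_stable U <->
  [/\ (('i *: X) @: U <= U)%VS, ((x i0 i1 + x i1 i0 + 'i *: gl_H) @: U <= U)%VS
    & ((4^-1 *: (x i0 i1 + x i1 i0 - 'i *: gl_H)) @: U <= U)%VS].
Proof.
have q0 : (4 : C)^-1 != 0 by rewrite invr_eq0 pnatr_eq0.
split=> [[sH sE sF]|[/(limg_subZ_eq _ _ i_neq0) sX sP /(limg_subZ_eq _ _ q0) sM]].
  have siH : (('i *: gl_H) @: U <= U)%VS by apply/limg_subZ_eq.
  split; first by apply/limg_subZ_eq => //; apply: limg_subB.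
    by apply: limg_subD => //; apply: limg_subD.
  by apply/limg_subZ_eq => //; apply: limg_subB => //; apply: limg_subD.
have [sS /(limg_subZ_eq _ _ i_neq0) sH] := limg_sub_addsub sP sM.
by have [sE sF] := limg_sub_addsub sS sX.
Qed.

Variable B : vT -> 'Hom(vT, C^o).
Hypothesis B_sym0 : forall u v, B u v = 0 -> B v u = 0.
Hypothesis B_def : forall u, B u u = 0 -> u = 0.
Hypothesis B_adj : forall j k u v, B u (x j k v) = B (x k j u) v.
Hypothesis B_addl : forall u u' v, B (u + u') v = B u v + B u' v.
Hypothesis B_oppl : forall u v, B (- u) v = - B u v.

Lemma antisym_decomposition_exists U :
  antisym_stable U -> exists s, irreducible_decomposition antisym_stable U s.
Proof.
apply: irreducible_decomposition_exists => {}U W sU sW UW.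
pose ops (jk : 'I_3 * 'I_3) := x jk.1 jk.2 - x jk.2 jk.1.
have adj jk : exists jk', forall u v, B u (ops jk v) = B (ops jk' u) v.
  exists (jk.2, jk.1) => u v; rewrite /ops /= !(add_lfunE, opp_lfunE).
  by rewrite linearB /= !B_adj B_addl B_oppl.
have [U' [sU' U0 UU']] := orthogonal_complement B_sym0 B_def adj
  (fun jk => sU jk.1 jk.2) (fun jk => sW jk.1 jk.2) UW.
by exists U'; split=> // j k; apply: (sU' (j, k)).
Qed.

Lemma gl2_decomposition_exists U :
  gl2_stable U -> exists s, irreducible_decomposition gl2_stable U s.
Proof.
apply: irreducible_decomposition_exists => {}U W [U1 U2 U3] [W1 W2 W3] UW.
(* [None] stands for the self-adjoint [gl_H]; the adjoint exchanges [Some true] and [Some false]. *)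
pose ops b := if b is Some b then if b then x i0 i1 else x i1 i0 else gl_H.
have adj b : exists b', forall u v, B u (ops b v) = B (ops b' u) v.
  case: b => [b|]; first by exists (Some (~~ b)) => u v; case: b; apply: B_adj.
  exists None => u v; rewrite /= /gl_H !(add_lfunE, opp_lfunE).
  by rewrite linearB /= !B_adj B_addl B_oppl.
have opsU b : (ops b @: U <= U)%VS by case: b => [[]|].
have opsW b : (ops b @: W <= W)%VS by case: b => [[]|].
have [U' [sU' U0 UU']] :=
  orthogonal_complement B_sym0 B_def adj opsU opsW UW.
exists U'; split=> //.
by split; [apply: (sU' None)|apply: (sU' (Some true))|apply: (sU' (Some false))].
Qed.

(* Both i(e_12 - e_21) and e_11 - e_22 are Cartan elements of the same copy of
   sl2, so they have the same weight multiplicities. *)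
Lemma antisym_multiplicity U s t :
  (forall j k, (x j k @: U <= U)%VS) ->
  irreducible_decomposition antisym_stable U s ->
  \dim (U :&: passmx.leigenspace gl_H (t%:R / 2))%VS =
  (\dim (U :&: passmx.leigenspace gl_H (t.+2%:R / 2))%VS +
   count (fun W => \dim W == t.+1) s)%N.
Proof.
move=> sU dec; have [XY YZ ZX] := antisym_bracket.
have [s' dec'] : exists s', irreducible_decomposition gl2_stable U s'.
  apply: gl2_decomposition_exists; split; rewrite ?sU //.
  by apply: limg_subB.
(* On every gl(2)-summand [gl_H] and ['i *: X] have the same weights, those of an sl2-module of that
   dimension. The triple for so(3) uses twice ['i *: X], whence c / 2 on the left. *)
have gl_so c : \dim (U :&: passmx.leigenspace gl_H (c / 2))%VS =
    \dim (U :&: passmx.leigenspace ((2 * 'i) *: X) c)%VS.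
  have plain W : gl2_stable W <-> gl2_stable W by [].
  rewrite (sl2_weights_decomposition gl2_triple plain _ dec').
  rewrite -(sl2_weights_decomposition (sl2_triple_rotated gl2_triple)
             gl2_stableE _ dec').
  congr (\dim (_ :&: _)); apply/vspaceP => v; rewrite !mem_leigenspace.
  have two0 : (2 : C) != 0 by rewrite pnatr_eq0.
  have -> : c *: v = 2 *: ((c / 2) *: v) by rewrite scalerA mulrC divfK.
  rewrite /X !scale_lfunE -[(2 * 'i) *: _]scalerA.
  by apply/eqP/eqP => [-> //|]; apply: scalerI.
rewrite (gl_so t%:R) (gl_so t.+2%:R).
exact: (sl2_multiplicity (sl2_triple_of_so3 XY YZ ZX) antisym_stableE t dec).
Qed.

End Gl3.

(** * Weights of covariant tensor representations *)

Lemma digits_inj n (b : nat) (u v : 'I_n -> nat) :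
  (forall i, u i < b)%N -> (forall i, v i < b)%N ->
  (\sum_i u i * b ^ i = \sum_i v i * b ^ i)%N -> u =1 v.
Proof.
elim: n u v => [|n IH] u v ub vb; first by move=> _ [].
have b0 : (0 < b)%N by apply: leq_ltn_trans (ub ord0).
have shift (w : 'I_n.+1 -> nat) : (\sum_i w i * b ^ i =
    w ord0 + (\sum_i w (lift ord0 i) * b ^ i) * b)%N.
  rewrite big_ord_recl expn0 muln1; congr (_ + _)%N; rewrite big_distrl /=.
  by apply: eq_bigr => i _; rewrite expnSr mulnA.
rewrite !shift => e.
have e0 : u ord0 = v ord0.
  have := congr1 (modn^~ b) e; rewrite /= ![(_ + _ * b)%N]addnC !modnMDl.
  by rewrite !modn_small.
move: e; rewrite e0 => /addnI/eqP; rewrite eqn_pmul2r // => /eqP e1.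
have {}IH := IH _ _ (fun i => ub (lift ord0 i)) (fun i => vb (lift ord0 i)) e1.
by move=> i; case: (unliftP ord0 i) => [j ->|->].
Qed.

Section TensorForm.
Variables (C : numClosedFieldType) (n N : nat).
Implicit Types (s t : tensor C n N) (w : {ffun 'I_N -> 'I_n.+1}).

Definition tensor_form s t : C := \sum_w (s w)^* * t w.

Lemma tensor_form_def s : tensor_form s s = 0 -> s = 0.
Proof.
move=> /eqP; rewrite psumr_eq0 => [/allP s0|w _]; last by rewrite mulrC mul_conjC_ge0.
apply/ffunP => w; rewrite ffunE; apply/eqP.
by have := s0 w (mem_index_enum w); rewrite mulrC mul_conjC_eq0.
Qed.

Lemma tensor_formC s t : tensor_form t s = (tensor_form s t)^*.
Proof.
rewrite /tensor_form rmorph_sum; apply: eq_bigr => w _.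
by rewrite rmorphM /= conjCK mulrC.
Qed.

Definition set_letter w (p : 'I_N) (i : 'I_n.+1) : {ffun 'I_N -> 'I_n.+1} :=
  [ffun q => if q == p then i else w q].

Lemma set_letterK w p i j : set_letter (set_letter w p i) p j = set_letter w p j.
Proof. by apply/ffunP => q; rewrite !ffunE; case: eqP. Qed.

Lemma set_letter_id w p i : (set_letter w p i == w) = (w p == i).
Proof.
apply/eqP/eqP => [<-|wp]; first by rewrite ffunE eqxx.
by apply/ffunP => q; rewrite ffunE; case: eqP => [->|].
Qed.

Lemma tensor_act_even i j t w :
  unit_odd i j = false ->
  tensor_act i j t w = \sum_(p | w p == i) t (set_letter w p j).
Proof.
by move=> ev; rewrite ffunE; apply: eq_bigr => p _; rewrite ev mul0n expr0 mul1r.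
Qed.

Lemma unit_oddC (i j : 'I_n.+1) : unit_odd i j = unit_odd j i.
Proof. exact: addbC. Qed.

Lemma unit_odd_diag (i : 'I_n.+1) : unit_odd i i = false.
Proof. exact: addbb. Qed.

(* No signs occur for even e_{ij}, so that e_{ji} is the adjoint of e_{ij}. *)
Lemma tensor_form_adj i j s t :
  unit_odd i j = false ->
  tensor_form s (tensor_act i j t) = tensor_form (tensor_act j i s) t.
Proof.
move=> ev; rewrite /tensor_form.
under eq_bigr do rewrite tensor_act_even // big_distrr big_mkcond /=.
under [RHS]eq_bigr do
  rewrite tensor_act_even 1?unit_oddC // rmorph_sum big_distrl big_mkcond /=.
rewrite exchange_big [RHS]exchange_big; apply: eq_bigr => p _.
rewrite -!big_mkcond /=.
(* At a fixed position [p], overwriting the letter j by i matches the words with j there with those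
   with i there. *)
rewrite (reindex_onto (fun w => set_letter w p i) (fun w => set_letter w p j)) /=.
  apply: eq_big => w; rewrite set_letterK set_letter_id.
    by rewrite ffunE eqxx eqxx.
  move=> /andP[_ wp]; suff /eqP -> : set_letter w p j == w by [].
  by rewrite set_letter_id.
by move=> w wp; rewrite set_letterK; apply/eqP; rewrite set_letter_id.
Qed.

Lemma tensor_act_diag i t w :
  tensor_act i i t w = #|[set p | w p == i]|%:R * t w.
Proof.
rewrite tensor_act_even ?unit_odd_diag // -sum1_card natr_sum big_distrl /=.
apply: eq_big => p; first by rewrite inE.
by move=> wp; rewrite mul1r; have /eqP -> : set_letter w p i == w
  by rewrite set_letter_id.
Qed.

End TensorForm.

(** * The Hermitian form, the Hamiltonian and the weights on V *)

Section Rep.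
Variables (C : numClosedFieldType) (V : gl_rep C 3) (N : nat).
Variable f : 'Hom(V, tensor C 3 N).
Hypothesis f_inj : lker f = 0%VS.
Hypothesis f_act : forall i j v, f (act V i j v) = tensor_act i j (f v).

Lemma act_bracket_even i j k l v :
  unit_odd i j = false ->
  act V i j (act V k l v) =
  act V k l (act V i j v) + (j == k)%:R *: act V i l v
    - (i == l)%:R *: act V k j v.
Proof.
move=> ev; have := congr1 (fun g : 'End(V) => g v) (act_bracket V i j k l).
rewrite /= ev /= !scale1r !(add_lfunE, opp_lfunE, scale_lfunE, comp_lfunE) => /eqP.
by rewrite subr_eq addrC addrA => /eqP.
Qed.

Definition rep_form_fun (u v : V) : C^o := tensor_form (f u) (f v).

Lemma rep_form_fun_linear u : linear (rep_form_fun u).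
Proof.
move=> a v w; rewrite /rep_form_fun /tensor_form /= linearP scaler_sumr -big_split /=.
by apply: eq_bigr => z _; rewrite !ffunE mulrDr mulrCA.
Qed.

HB.instance Definition _ u :=
  GRing.isLinear.Build _ _ _ _ (rep_form_fun u) (rep_form_fun_linear u).

Definition rep_form (u : V) : 'Hom(V, C^o) := linfun (rep_form_fun u).

Lemma rep_formE u v : rep_form u v = tensor_form (f u) (f v).
Proof. by rewrite lfunE. Qed.

Lemma f_injective : injective f.
Proof. by apply/lker0P; rewrite f_inj. Qed.

Lemma rep_form_sym0 u v : rep_form u v = 0 -> rep_form v u = 0.
Proof. by rewrite !rep_formE => uv; rewrite tensor_formC uv rmorph0. Qed.

Lemma rep_form_def u : rep_form u u = 0 -> u = 0.
Proof.
by rewrite rep_formE => /tensor_form_def fu; apply: f_injective; rewrite linear0.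
Qed.

Lemma rep_form_addl u u' v : rep_form (u + u') v = rep_form u v + rep_form u' v.
Proof.
rewrite !rep_formE linearD /tensor_form -big_split; apply: eq_bigr => w _ /=.
by rewrite ffunE rmorphD mulrDl.
Qed.

Lemma rep_form_oppl u v : rep_form (- u) v = - rep_form u v.
Proof.
rewrite !rep_formE linearN /tensor_form -sumrN; apply: eq_bigr => w _ /=.
by rewrite ffunE rmorphN mulNr.
Qed.

Definition u3 (j k : 'I_3) : 'End(V) := act V (lift ord0 j) (lift ord0 k).

Lemma rep_form_adj j k u v : rep_form u (u3 j k v) = rep_form (u3 k j u) v.
Proof. by rewrite !rep_formE !f_act tensor_form_adj. Qed.

Lemma u3_bracket i j k l v :
  u3 i j (u3 k l v) =
  u3 k l (u3 i j v) + (j == k)%:R *: u3 i l v - (i == l)%:R *: u3 k j v.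
Proof. by rewrite /u3 act_bracket_even // !(inj_eq lift_inj). Qed.

(** The Hamiltonian commutes with u(3): e_{00} commutes with it, and the sum of the e_{jj} with j >=
    1 is central in it. *)
Lemma energy_space_stable hbar omega E j k :
  (u3 j k @: energy_space V hbar omega E <= energy_space V hbar omega E)%VS.
Proof.
apply/limg_subP => v; rewrite /energy_space !mem_leigenspace => /eqP Hv.
suff -> : Hamiltonian V hbar omega (u3 j k v) = u3 j k (Hamiltonian V hbar omega v).
  by rewrite Hv linearZ.
rewrite /Hamiltonian !(scale_lfunE, add_lfunE, sum_lfunE).
rewrite [RHS]linearZ /= [in RHS]linearD /= linearZ /= linear_sum /=.
congr (_ *: (_ *: _ + _)).
  by rewrite act_bracket_even // /= !scale0r addr0 subr0.
(* The Kronecker terms of the brackets: the index i = j gives e_{jk} and i = k gives - e_{jk}. *)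
apply: (@etrans _ _ (_ + (u3 j k v - u3 j k v))); last by rewrite subrr addr0.
under eq_bigr => i _ do rewrite -/(u3 i i) u3_bracket -/(u3 i i) -addrA.
rewrite big_split /=; congr (_ + _); rewrite sumrB.
rewrite (bigD1 j) //= eqxx scale1r big1 ?addr0; last first.
  by move=> i /negPf ->; rewrite scale0r.
rewrite (bigD1 k) //= eqxx scale1r big1 ?addr0 //.
by move=> i /negPf ->; rewrite scale0r.
Qed.

(** Both the base of a positional code for weights and a bound on their degrees: the letter counts
    of a word of length [N] are digits in base [b]. *)
Variable b : nat.
Hypothesis N_lt_b : (N < b)%N.

Let letters (w : {ffun 'I_N -> 'I_4}) i := #|[set p | w p == i]|.

Let letters_lt w i : (letters w i < b)%N.
Proof. by rewrite (leq_ltn_trans (max_card _)) ?card_ord. Qed.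

Let letters_mdeg w : (mdeg [multinom letters w i | i < 4] < b)%N.
Proof.
apply: leq_ltn_trans N_lt_b; rewrite mdegE; under eq_bigr do
  rewrite mnmE /letters -sum1_card.
rewrite (exchange_big_dep predT) //= -[X in (_ <= X)%N]card_ord -sum1_card.
apply: leq_sum => p _; rewrite (eq_bigl (pred1 (w p))) ?big_pred1_eq //.
by move=> i; rewrite inE eq_sym.
Qed.

Lemma act_diag_eval i v w : f (act V i i v) w = (letters w i)%:R * f v w.
Proof. by rewrite f_act tensor_act_diag. Qed.

(* A diagonal operator whose eigenvalue determines the whole weight, the
   entries of the weight being its digits in base b. *)
Let code_op : 'End(V) := \sum_(i < 4) (b ^ i)%:R *: act V i i.
Let code (u : 'I_4 -> nat) : nat := (\sum_i u i * b ^ i)%N.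

Let code_op_eval v w : f (code_op v) w = (code (letters w))%:R * f v w.
Proof.
rewrite /code_op sum_lfunE linear_sum /= sum_ffunE natr_sum big_distrl /=.
apply: eq_bigr => i _; rewrite scale_lfunE linearZ /= ffunE act_diag_eval.
by rewrite natrM -mulrA mulrCA.
Qed.

Lemma mem_weight_space (mu : 'X_{1..4}) v :
  reflect (forall i, act V i i v = (mu i)%:R *: v) (v \in weight_space V mu).
Proof.
rewrite /weight_space; apply: (iffP idP) => [vmu i|vi].
  apply/eqP; rewrite -mem_leigenspace; move: v vmu; apply/subvP.
  exact: bigcapv_inf.
rewrite memvE; apply/subv_bigcapP => i _.
by rewrite -memvE mem_leigenspace vi.
Qed.

(** [act V i i] multiplies the coordinate of [f v] at a word by the number of its letters i. An
    eigenvector of [code_op] is thus supported on words with the code of [mu], and these have letter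
    counts [mu]. *)
Let code_space (mu : 'X_{1..4}) :
  (mdeg mu < b)%N ->
  passmx.leigenspace code_op (code mu)%:R = weight_space V mu.
Proof.
move=> muN; apply/vspaceP => v; rewrite mem_leigenspace.
have mu_lt i : (mu i < b)%N.
  by apply: leq_ltn_trans muN; rewrite mdegE (bigD1 i) //= leq_addr.
apply/eqP/mem_weight_space => [cv i|vmu]; last first.
  rewrite /code_op sum_lfunE natr_sum scaler_suml; apply: eq_bigr => i _.
  by rewrite scale_lfunE vmu scalerA natrM mulrC.
apply: f_injective; apply/ffunP => w; rewrite linearZ /= ffunE act_diag_eval.
have [->|fvw] := eqVneq (f v w) 0; first by rewrite mulr0 scaler0.
have := congr1 (fun u => f u w) cv; rewrite linearZ /= code_op_eval ffunE.
move/(mulIf fvw)/eqP; rewrite eqr_nat => /eqP e.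
by rewrite (digits_inj (letters_lt w) mu_lt e).
Qed.

Lemma dim_weight_split (U : {vspace V}) :
  (forall i, (act V i i @: U <= U)%VS) ->
  \dim U = (\sum_(mu : 'X_{1..4 < b}) \dim (U :&: weight_space V mu))%N.
Proof.
move=> sU; set s := [seq (code (bmnm mu))%:R : C | mu <- index_enum 'X_{1..4 < b}].
rewrite (@dim_eigen_split _ _ code_op s).
- rewrite big_map; apply: eq_bigr => mu _; rewrite code_space //.
  by rewrite bmdeg.
- rewrite map_inj_in_uniq ?index_enum_uniq // => mu mu' _ _ /eqP.
  rewrite eqr_nat => /eqP e.
  apply: val_inj; apply/mnmP; apply: digits_inj e => i.
    by apply: leq_ltn_trans (bmdeg mu); rewrite mdegE (bigD1 i) //= leq_addr.
  by apply: leq_ltn_trans (bmdeg mu'); rewrite mdegE (bigD1 i) //= leq_addr.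
- apply/limg_subP => v vU; rewrite sum_lfunE rpred_sum // => i _.
  by rewrite scale_lfunE rpredZ //; have /limg_subP := sU i; apply.
(* The product of the [code_op] - c over [s] vanishes coordinate by coordinate: at [w] one of the
   factors is 0. *)
move=> v _; apply: f_injective; apply/ffunP => w; rewrite linear0 ffunE.
have: (code (letters w))%:R \in s.
  apply/mapP; exists (BMultinom (letters_mdeg w)); first by rewrite mem_index_enum.
  by congr (_%:R); apply: eq_bigr => i _; rewrite mnmE.
have step u c : f (code_op u - c *: u) w = ((code (letters w))%:R - c) * f u w.
  by rewrite linearB linearZ /= !ffunE code_op_eval mulrBl.
elim: s v => // c s IH v; rewrite inE => /orP[/eqP cw|]; last exact: IH.
rewrite /=; have: f (code_op v - c *: v) w = 0 by rewrite step cw subrr mul0r.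
move: (_ - _); elim: s {IH cw} => [|c' s IH] u u0 //=.
by apply: IH; rewrite step u0 mulr0.
Qed.

(** For n = 3 the prefactor contains 1/2, and 3 mu_0 + mu_1 + mu_2 + mu_3 = |mu| + 2 mu_0. *)
Lemma Hamiltonian_weight hbar omega (mu : 'X_{1..4}) v :
  v \in weight_space V mu ->
  Hamiltonian V hbar omega v =
  (hbar * omega * ((mdeg mu)%:R / 2 + (mu ord0)%:R)) *: v.
Proof.
move=> /mem_weight_space vmu.
rewrite /Hamiltonian !(scale_lfunE, add_lfunE, sum_lfunE) vmu.
under eq_bigr do rewrite vmu.
rewrite -scaler_suml scalerA -scalerDl scalerA; congr (_ *: _).
set S := \sum_(_ < _) _.
have -> : (mdeg mu)%:R = (mu ord0)%:R + S.
  by rewrite mdegE big_ord_recl natrD natr_sum.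
have -> : 3 - 1 = 2 :> C by ring.
by field.
Qed.

(** The Hamiltonian and [gl_H] are scalar on each weight space, which therefore lies in their joint
    eigenspace or meets it in 0. *)
Lemma dim_energy_weight hbar omega E c :
  hbar * omega != 0 ->
  \dim (energy_space V hbar omega E :&: passmx.leigenspace (gl_H u3) c)%VS =
  (\sum_(mu : 'X_{1..4 < b}
      | ((E == (mdeg mu)%:R / 2 + (mu ord0)%:R) &&
         (c == (mu (lift ord0 (ord0 : 'I_3)))%:R
               - (mu (lift ord0 (lift ord0 ord0 : 'I_3)))%:R))%R)
     \dim (weight_space V mu))%N.
Proof.
move=> ho0; set U := (_ :&: _)%VS.
have UP v : (v \in U) = (Hamiltonian V hbar omega v == hbar * omega * E *: v) &&
    (u3 ord0 ord0 v - u3 (lift ord0 ord0) (lift ord0 ord0) v == c *: v).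
  by rewrite memv_cap !mem_leigenspace /gl_H add_lfunE opp_lfunE.
have diagC i j v : act V i i (act V j j v) = act V j j (act V i i v).
  rewrite act_bracket_even ?unit_odd_diag //; case: (eqVneq i j) => [->|].
    by rewrite addrK.
  by rewrite !scale0r addr0 subr0.
rewrite dim_weight_split; last first.
  move=> i; apply/limg_subP => v; rewrite !UP => /andP[/eqP Hv /eqP hv].
  apply/andP; split; apply/eqP.
    rewrite -[RHS]linearZ /= -Hv.
    rewrite /Hamiltonian !(scale_lfunE, add_lfunE, sum_lfunE).
    rewrite [RHS]linearZ /= [in RHS]linearD /= linearZ /= linear_sum /= diagC.
    by under eq_bigr do rewrite diagC.
  by rewrite -[RHS]linearZ /= -hv linearB /u3 !(diagC _ i).
rewrite [RHS]big_mkcond; apply: eq_bigr => mu _.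
have UE v : v \in weight_space V mu -> (v \in U) =
    ((E == (mdeg mu)%:R / 2 + (mu ord0)%:R) &&
     (c == (mu (lift ord0 (ord0 : 'I_3)))%:R
           - (mu (lift ord0 (lift ord0 ord0 : 'I_3)))%:R)) || (v == 0).
  move=> vmu; rewrite UP (Hamiltonian_weight _ _ vmu) /u3.
  have /mem_weight_space vE := vmu; rewrite !vE -scalerBl.
  rewrite -![_ *: v == _]subr_eq0 -!scalerBl -mulrBr !scaler_eq0 mulf_eq0.
  rewrite (negPf ho0) /= !subr_eq0 -orb_andl.
  by rewrite [_ == E]eq_sym [_ == c]eq_sym.
have [inU|ninU] := boolP (_ && _).
  by congr (\dim _); apply/capv_idPr/subvP => v vmu; rewrite UE // inU.
apply/eqP; rewrite dimv_eq0 -subv0; apply/subvP => v /memv_capP[vU vmu].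
by move: vU; rewrite UE // (negPf ninU) memv0.
Qed.

End Rep.

Section Multiplicity.
Variables (C : numClosedFieldType) (V : gl_rep C 3).

Lemma so_decomposition_seq U k (W : 'I_k -> {vspace V}) :
  so_decomposition U W <->
  irreducible_decomposition (antisym_stable (u3 V)) U (map W (enum 'I_k)).
Proof.
have sumE : (\sum_(X <- map W (enum 'I_k)) X = \sum_(i < k) W i)%VS.
  by rewrite big_map big_enum.
have dimE : (\sum_(X <- map W (enum 'I_k)) \dim X = \sum_(i < k) \dim (W i))%N.
  by rewrite big_map big_enum.
split=> [[sW dW irr]|[sW dW irr]].
  split; rewrite ?sumE ?dimE //; first by rewrite -sW; exact/directvP.
  by move=> _ /mapP[i _ ->]; exact: irr.
split; first by rewrite -sumE.
  by apply/directvP; rewrite /= -dimE -dW -sW sumE.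
by move=> i; apply: irr; rewrite map_f ?mem_enum.
Qed.

(** The form pulled back from the tensor power makes a decomposition exist; weight multiplicities of
    [U] fix the number of summands of dimension t + 1 in any of them. *)
Lemma covariant_so_multiplicity hbar omega E t (m : int) :
  covariant_tensor_rep V ->
  let U := energy_space V hbar omega E in
  Posz (\dim (U :&: passmx.leigenspace (gl_H (u3 V)) (t%:R / 2))%VS) =
  m + Posz (\dim (U :&: passmx.leigenspace (gl_H (u3 V)) (t.+2%:R / 2))%VS) ->
  so_multiplicity U t.+1 m.
Proof.
move=> [_ [N [f [f_inj f_act]]]] U dimU.
have sU j k : (u3 V j k @: U <= U)%VS by apply: energy_space_stable.
have br := @u3_bracket C V.
split.
  have [s [sU' dU irr]] := antisym_decomposition_exists (@rep_form_sym0 C V N f)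
    (rep_form_def f_inj) (rep_form_adj f_act) (@rep_form_addl C V N f)
    (@rep_form_oppl C V N f) (fun j k => limg_subB (sU j k) (sU k j)).
  exists (size s), (fun i => nth 0%VS s i); apply/so_decomposition_seq.
  suff -> : [seq nth 0%VS s (val i) | i <- enum 'I_(size s)] = s by [].
  by rewrite (map_comp (nth 0%VS s)) val_enum_ord map_nth_iota0 ?take_size.
move=> k W /so_decomposition_seq dec.
have := antisym_multiplicity br (@rep_form_sym0 C V N f) (rep_form_def f_inj)
  (rep_form_adj f_act) (@rep_form_addl C V N f) (@rep_form_oppl C V N f) t sU dec.
have -> : count (fun X => \dim X == t.+1) (map W (enum 'I_k)) =
          #|[set i | \dim (W i) == t.+1]|.
  rewrite count_map -sum1_count big_enum_cond -sum1_card /=.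
  by apply: eq_bigl => i; rewrite inE.
move=> e; apply: (addIr (Posz
  (\dim (U :&: passmx.leigenspace (gl_H (u3 V)) (t.+2%:R / 2))%VS))).
by rewrite -dimU e PoszD addrC.
Qed.

End Multiplicity.

(** * Tableaux and Gelfand-Tsetlin patterns *)

Section Cells.
Variable s : seq nat.

Lemma cell_sum (F : nat -> nat -> nat) :
  (\sum_(c : cell s) F (cell_row c) (cell_col c) =
   \sum_(i < size s) \sum_(j < nth 0 s i) F i j)%N.
Proof.
exact/esym/(@sig_big_dep _ _ _ _ (fun i : 'I_(size s) => 'I_(nth 0%N s i))
  xpredT (fun _ => xpredT) (fun i j => F i j)).
Qed.

Lemma cell_exists i j : (j < nth 0%N s i)%N ->
  exists c : cell s, cell_row c = i /\ cell_col c = j.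
Proof.
move=> ji; have i_lt : (i < size s)%N.
  by rewrite ltnNge; apply/negP => /(nth_default 0%N) e; rewrite e in ji.
pose J (i : 'I_(size s)) := 'I_(nth 0%N s i).
by exists (@existT _ J (Ordinal i_lt) (Ordinal ji : J (Ordinal i_lt))).
Qed.

Lemma cell_inj (c d : cell s) :
  cell_row c = cell_row d -> cell_col c = cell_col d -> c = d.
Proof.
case: c d => [i j] [i' j'] /= ei; rewrite /cell_row /= in ei.
have {}ei := val_inj ei; case: i' / ei j' => j' ej.
by rewrite (val_inj ej : j = j').
Qed.

Lemma cell_col_lt (c : cell s) : (cell_col c < nth 0%N s (cell_row c))%N.
Proof. exact: ltn_ord. Qed.

Lemma cell_row_lt (c : cell s) : (cell_row c < size s)%N.
Proof. exact: ltn_ord. Qed.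

Lemma sum_ord_interval (n a b : nat) :
  (\sum_(j < n) (a <= j < b) = minn b n - minn a n)%N.
Proof.
elim: n => [|n IH]; first by rewrite big_ord0 !minn0.
by rewrite big_ord_recr /= IH; case: (ltnP a b); lia.
Qed.

Lemma card_row_interval (r a b : nat) :
  #|[set c : cell s | (cell_row c == r) && (a <= cell_col c < b)%N]| =
  (minn b (nth 0 s r) - minn a (nth 0 s r))%N.
Proof.
rewrite -sum1_card; under eq_bigl do rewrite inE.
rewrite big_mkcond /=.
pose F i j := nat_of_bool ((i == r) && (a <= j < b)%N).
rewrite (eq_bigr (fun c => F (cell_row c) (cell_col c))); last first.
  by move=> c _; rewrite /F; case: (_ && _).
rewrite cell_sum /=.
have [r_lt|r_ge] := ltnP r (size s); last first.
  rewrite nth_default // !minn0 subn0.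
  rewrite big1 // => i _; rewrite big1 // => j _.
  by rewrite /F ltn_eqF ?(leq_trans (ltn_ord i)).
rewrite (bigD1 (Ordinal r_lt)) //= [X in (_ + X)%N]big1 ?addn0 => [|i /negPf ir].
  by rewrite -sum_ord_interval; apply: eq_bigr => j _; rewrite /F eqxx.
by rewrite big1 // => j _; rewrite /F -[r]/(val (Ordinal r_lt)) val_eqE ir.
Qed.

(** Within a row, a set closed to the left is an initial segment, hence given by its cardinality. *)
Lemma row_downset (r : nat) (P : pred (cell s)) (c : cell s) :
  (forall c d, cell_row c = r -> cell_row d = r ->
     (cell_col d <= cell_col c)%N -> P c -> P d) ->
  cell_row c = r ->
  P c = (cell_col c < #|[set d | (cell_row d == r) && P d]|)%N.
Proof.
move=> down cr; have c_lt := cell_col_lt c; rewrite cr in c_lt.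
have card k : (k <= nth 0 s r)%N ->
    #|[set d : cell s | (cell_row d == r) && (0 <= cell_col d < k)%N]| = k.
  by move=> kr; rewrite card_row_interval min0n subn0; apply/minn_idPl.
have [Pc|nPc] := boolP (P c).
  apply/esym; rewrite -{1}(card (cell_col c).+1 c_lt); apply/subset_leq_card/subsetP.
  move=> d; rewrite !inE ltnS => /andP[/eqP dr dc]; rewrite dr eqxx /=.
  exact: (down c).
apply/esym/negbTE; rewrite -leqNgt -[X in (_ <= X)%N](card _ (ltnW c_lt)).
apply/subset_leq_card/subsetP => d; rewrite !inE => /andP[/eqP dr Pd].
rewrite dr eqxx /= ltnNge; apply: contra nPc => cd.
exact: (down d).
Qed.

End Cells.

Section GelfandTsetlin.
Variable s : seq nat.
Hypothesis s_partition : is_partition s.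
Hypothesis size_s : (size s <= 3)%N.

Local Notation L i := (nth 0%N s i).

Lemma partition_nth_leq i j : (i <= j)%N -> (L j <= L i)%N.
Proof.
move=> ij; have [j_lt|j_ge] := ltnP j (size s); last by rewrite nth_default.
have geq_trans : transitive geq by move=> a b c ba ac; apply: leq_trans ac ba.
apply: (sorted_leq_nth geq_trans) => //; try exact: leqnn.
  by rewrite inE (leq_ltn_trans ij).
Qed.

(* The tableau of the Gelfand-Tsetlin pattern (l; k1, k2; shape), with letters
   0, 1, 2: row 0 has l letters 0 and k1 - l letters 1, row 1 has k2 letters 1,
   and all other letters are 2. *)
Definition gt_entry (l k1 k2 i j : nat) : nat :=
  if i == 0%N then ((l <= j) + (k1 <= j))%N
  else if i == 1%N then (k2 <= j).+1 else 2.

Lemma gt_entry_lt l k1 k2 i j : (gt_entry l k1 k2 i j < 3)%N.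
Proof. by rewrite /gt_entry; case: eqP => _; [|case: eqP => _]; lia. Qed.

Definition gt_tableau (l k1 k2 : nat) : {ffun cell s -> 'I_3} :=
  [ffun c => Ordinal (gt_entry_lt l k1 k2 (cell_row c) (cell_col c))].

Definition row_count (T : {ffun cell s -> 'I_3}) (r v : nat) : nat :=
  #|[set c | (cell_row c == r) && (T c <= v)%N]|.

(** The interlacing inequalities between the rows [L 0, L 1, L 2], then [k1, k2], then [l]. *)
Definition gt_valid (l k1 k2 : nat) : bool :=
  [&& L 1 <= k1 <= L 0, L 2 <= k2 <= L 1 & k2 <= l <= k1]%N.

Lemma semistandardP (T : {ffun cell s -> 'I_3}) :
  reflect ((forall c d, cell_row c = cell_row d ->
              (cell_col c < cell_col d)%N -> (T c <= T d)%N) /\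
           (forall c d, cell_col c = cell_col d ->
              (cell_row c < cell_row d)%N -> (T c < T d)%N))
          (semistandard T).
Proof.
apply: (iffP forallP) => [H|[H1 H2] c].
  split=> c d e lt; have /forallP/(_ d)/andP[H1 H2] := H c.
    by move/implyP: H1; apply; rewrite e eqxx.
  by move/implyP: H2; apply; rewrite e eqxx.
apply/forallP => d; apply/andP; split; apply/implyP => /andP[/eqP e lt].
  exact: H1.
exact: H2.
Qed.

(** Entries increase strictly down a column, and all cells above [c] exist because row lengths do
    not increase. *)
Lemma semistandard_row_leq (T : {ffun cell s -> 'I_3}) c :
  semistandard T -> (cell_row c <= T c)%N.
Proof.
move=> /semistandardP[_ col]; have [k ck] := ubnP (cell_row c).
elim: k c ck => // k IH c; rewrite ltnS.
case E: (cell_row c) => [//|r] rk; have c_lt := cell_col_lt c.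
have [d [dr dc]] : exists d : cell s, cell_row d = r /\ cell_col d = cell_col c.
  by apply: cell_exists; apply: leq_trans c_lt _; apply: partition_nth_leq; rewrite E.
have := IH d; rewrite dr => /(_ rk) rd; apply: leq_ltn_trans rd _.
by apply: col; rewrite ?dr ?E.
Qed.

Lemma semistandard_entry_lt (T : {ffun cell s -> 'I_3}) r v c :
  semistandard T -> cell_row c = r ->
  (T c <= v)%N = (cell_col c < row_count T r v)%N.
Proof.
move=> /semistandardP[row _] cr.
apply: (@row_downset s r) => // {cr} {}c d cr dr.
rewrite leq_eqVlt => /orP[/eqP e|lt] /=; last first.
  by apply: leq_trans; apply: row; rewrite ?cr ?dr.
by rewrite (@cell_inj s d c) ?cr ?dr.
Qed.

(** Rows increase weakly and row r has no letter below r, so each row is fixed by how many of its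
    letters are at most 0 and at most 1. *)
Lemma gt_tableau_onto T :
  semistandard T ->
  gt_tableau (row_count T 0 0) (row_count T 0 1) (row_count T 1 1) = T.
Proof.
move=> ssT; apply/ffunP => c; rewrite ffunE; apply: val_inj => /=.
have r3 : (cell_row c < 3)%N := leq_trans (cell_row_lt c) size_s.
have entry r v := @semistandard_entry_lt T r v c ssT.
have rT := semistandard_row_leq c ssT; have T3 := ltn_ord (T c).
rewrite /gt_entry; case: eqP => [c0|cn0].
  rewrite [(row_count T 0 0 <= _)%N]leqNgt [(row_count T 0 1 <= _)%N]leqNgt.
  by rewrite -!entry //; case: (T c) => -[|[|[|]]].
case: eqP => [c1|cn1].
  rewrite leqNgt -entry //; move: rT; rewrite c1.
  by case: (T c) => -[|[|[|]]].
apply/eqP; rewrite eqn_leq; apply/andP; split=> //.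
by apply: leq_trans rT; lia.
Qed.

(** No interlacing is assumed, so minima and maxima truncate the parameters; for an interlacing
    pattern the counts are [l], [k1], [k2]. *)
Lemma row_count_gt l k1 k2 :
  [/\ row_count (gt_tableau l k1 k2) 0 0 = minn (minn l k1) (L 0),
      row_count (gt_tableau l k1 k2) 0 1 = minn (maxn l k1) (L 0) &
      row_count (gt_tableau l k1 k2) 1 1 = minn k2 (L 1)].
Proof.
have card r k (T := gt_tableau l k1 k2) v :
    (forall c : cell s, cell_row c = r -> (T c <= v)%N = (cell_col c < k)%N) ->
    row_count T r v = minn k (L r).
  move=> Tv; rewrite -[RHS]subn0 -{2}(min0n (L r)) -card_row_interval.
  apply: eq_card => c; rewrite !inE; case: eqP => //= cr.
  by rewrite Tv.
split; apply: card => c cr; rewrite ffunE /= /gt_entry cr /=; lia.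
Qed.

Lemma gt_tableau_semistandard l k1 k2 :
  gt_valid l k1 k2 -> semistandard (gt_tableau l k1 k2).
Proof.
move=> /and3P[/andP[a1 a2] /andP[b1 b2] /andP[c1 c2]].
apply/semistandardP; split=> c d; rewrite !ffunE /= /gt_entry => e lt.
  by rewrite e; case: eqP => _; [|case: eqP => _]; lia.
have d3 : (cell_row d < 3)%N := leq_trans (cell_row_lt d) size_s.
have dl := cell_col_lt d; rewrite e.
have [[rc rd]|[rc rd]|[rc rd]] : [\/ cell_row c = 0%N /\ cell_row d = 1%N,
    cell_row c = 0%N /\ cell_row d = 2%N | cell_row c = 1%N /\ cell_row d = 2%N].
  case: (cell_row c) (cell_row d) lt d3 => [|[|?]] [|[|[|?]]] //= _ _;
    by [apply: Or31|apply: Or32|apply: Or33].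
all: rewrite rc rd /=; rewrite rd in dl; lia.
Qed.

Lemma gt_validP l k1 k2 (T := gt_tableau l k1 k2) :
  semistandard T -> row_count T 0 0 = l -> row_count T 0 1 = k1 ->
  row_count T 1 1 = k2 -> gt_valid l k1 k2.
Proof.
move=> /semistandardP[_ col]; have [-> -> ->] := row_count_gt l k1 k2.
move=> e1 e2 e3.
have below r j : (j < L r.+1)%N ->
    (gt_entry l k1 k2 r j < gt_entry l k1 k2 r.+1 j)%N.
  move=> j_lt; have [c [cr cc]] := cell_exists j_lt.
  have jr : (j < L r)%N by apply: leq_trans j_lt (partition_nth_leq _).
  have [d [dr dc]] := cell_exists jr.
  by have := col d c; rewrite dc cc dr cr !ffunE /= dc cc dr cr; apply.
(* Each lower bound is tested in one column: if k1 < L 1, l < k2 or k2 < L 2, then column k1, l or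
   k2, respectively, would fail to increase strictly. *)
have b1 := below 0%N k1; have b2 := below 0%N l; have b3 := below 1%N k2.
rewrite /gt_entry /= in b1 b2 b3; rewrite /gt_valid; lia.
Qed.

Definition letter_count (T : {ffun cell s -> 'I_3}) (v : nat) : nat :=
  #|[set c | T c == v :> nat]|.

Lemma letter_count_gt l k1 k2 (T := gt_tableau l k1 k2) :
  gt_valid l k1 k2 ->
  letter_count T 0 = l /\ letter_count T 1 = (k1 + k2 - l)%N.
Proof.
move=> /and3P[/andP[a1 a2] /andP[b1 b2] /andP[c1 c2]].
have split_rows v a b a' b' :
    (forall c : cell s, (T c == v :> nat) =
       (cell_row c == 0) && (a <= cell_col c < b)%N ||
       (cell_row c == 1) && (a' <= cell_col c < b')%N) ->
    letter_count T v = (minn b (L 0) - minn a (L 0) +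
                        (minn b' (L 1) - minn a' (L 1)))%N.
  move=> Tv; rewrite -!card_row_interval -cardsUI.
  rewrite [X in (_ + X)%N]eq_card0 ?addn0 => [|c]; last first.
    by rewrite !inE; case: eqP => //= ->; rewrite /= andbF.
  by apply: eq_card => c; rewrite !inE Tv.
split.
  rewrite (split_rows _ 0%N l 0%N 0%N); first by lia.
  move=> c; rewrite ffunE /= /gt_entry.
  by case: (cell_row c) => [|[|r]] /=; lia.
rewrite (split_rows _ l k1 0%N k2); first by lia.
move=> c; rewrite ffunE /= /gt_entry.
by case: (cell_row c) => [|[|r]] /=; lia.
Qed.

Lemma sum_semistandard (A : zmodType) (F : nat -> nat -> A) :
  \sum_(T : {ffun cell s -> 'I_3} | semistandard T)
     F (letter_count T 0) (letter_count T 1) =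
  \sum_(L 1 <= k1 < (L 0).+1) \sum_(L 2 <= k2 < (L 1).+1)
     \sum_(k2 <= l < k1.+1) F l (k1 + k2 - l)%N.
Proof.
pose M := (L 0).+1.
have L10 : (L 1 <= L 0)%N by apply: partition_nth_leq.
pose h (t : 'I_M * 'I_M * 'I_M) := gt_tableau t.1.1 t.1.2 t.2.
pose h' (T : {ffun cell s -> 'I_3}) : 'I_M * 'I_M * 'I_M :=
  (inord (row_count T 0 0), inord (row_count T 0 1), inord (row_count T 1 1)).
have rc_lt (T : {ffun cell s -> 'I_3}) r v : (row_count T r v < M)%N.
  rewrite ltnS; apply: leq_trans (_ : (L r <= _)%N); last exact: partition_nth_leq.
  have <- : #|[set c : cell s | (cell_row c == r) && (0 <= cell_col c < L r)%N]|
            = L r by rewrite card_row_interval min0n subn0 minnn.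
  apply/subset_leq_card/subsetP => c; rewrite !inE => /andP[/eqP cr _].
  by rewrite cr eqxx /= -cr cell_col_lt.
rewrite (reindex_onto h h') => [|T ssT]; last first.
  by rewrite /h /h' /= !inordK ?gt_tableau_onto.
transitivity (\sum_(t : 'I_M * 'I_M * 'I_M | gt_valid t.1.1 t.1.2 t.2)
    F t.1.1 (t.1.2 + t.2 - t.1.1)%N).
  have validE t : semistandard (h t) && (h' (h t) == t) = gt_valid t.1.1 t.1.2 t.2.
    case: t => [[l k1] k2]; apply/andP/idP => /= [[sst /eqP[e1 e2 e3]]|valid].
      apply: (gt_validP sst).
      - by rewrite -[RHS](congr1 val e1) /= inordK.
      - by rewrite -[RHS](congr1 val e2) /= inordK.
      - by rewrite -[RHS](congr1 val e3) /= inordK.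
    split; first exact: gt_tableau_semistandard.
    rewrite /h' /h /=; have [-> -> ->] := row_count_gt l k1 k2.
    have /and3P[/andP[a1 a2] /andP[b1 b2] /andP[c1 c2]] := valid.
    by apply/eqP; congr (_, _, _); apply: val_inj; rewrite /= inordK; lia.
  apply: eq_big => // t; rewrite validE => valid.
  by have [-> ->] := letter_count_gt valid.
pose G (p : 'I_M * 'I_M) (k2 : 'I_M) := F p.1 (p.2 + k2 - p.1)%N.
rewrite -(pair_big_dep xpredT
  (fun (p : 'I_M * 'I_M) (k2 : 'I_M) => gt_valid p.1 p.2 k2) G) /=.
rewrite -(pair_big_dep xpredT (fun _ _ => true) (fun l k1 : 'I_M =>
  \sum_(k2 : 'I_M | gt_valid l k1 k2) G (l, k1) k2)) /=.
rewrite exchange_big big_geq_mkord [RHS]big_mkcond /=; apply: eq_bigr => k1 _.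
case: ifP => k1L; last first.
  rewrite big1 // => l _; rewrite big_pred0 // => k2.
  by rewrite /gt_valid k1L.
have k1M := ltn_ord k1; have M0 : (L 1 < M)%N by rewrite ltnS.
rewrite (exchange_big_dep xpredT) //= (big_nat_widen _ _ M) // big_geq_mkord.
rewrite [RHS]big_mkcond /=; apply: eq_bigr => k2 _.
case: ifP => k2L; last first.
  rewrite big_pred0 // => l; apply/negbTE/negP => /and3P[_ + _].
  by rewrite ltnS in k2L; rewrite andbC k2L.
rewrite (big_nat_widen _ _ M) // big_geq_mkord; apply: eq_bigl => l.
have k1L0 : (k1 <= L 0)%N by rewrite -ltnS.
rewrite /gt_valid k1L k1L0 /=; move: k2L; rewrite ltnS.
by case/andP=> -> ->; rewrite /= ltnS andbC.
Qed.

End GelfandTsetlin.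

(* For the string of weights -d, -d+2, ..., d, the coefficient of X^j is the
   number of weights equal to j minus the number equal to j + 1.  The sum is
   the quotient (X^(d+1) + (-1)^d) / (X + 1). *)
Definition alt_poly (d : nat) : {poly int} := \poly_(j < d.+1) (-1) ^+ (d - j).

(** For l0 >= l1 >= l2, the coefficient of X^j is the multiplicity of spin j in the irreducible
    u(3)-module of highest weight (l0, l1, l2). Single summands may have negative coefficients. *)
Definition branch_poly (l0 l1 l2 : nat) : {poly int} :=
  \sum_(l1 <= k1 < l0.+1) \sum_(l2 <= k2 < l1.+1) alt_poly (k1 - k2).

Lemma sum_double_eq n e :
  \sum_(i < n) (i.*2 == e)%:R = (~~ odd e && (e./2 < n)%N)%:R :> int.
Proof.
elim: n => [|n IH]; first by rewrite big_ord0 ltn0 andbF.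
rewrite big_ord_recr /= IH -natrD; congr (_%:R).
have [<-|ne] := eqVneq n.*2 e; first by rewrite odd_double doubleK ltnn ltnSn.
by case: (boolP (odd e)) => odd_e //=; rewrite addn0; congr nat_of_bool; lia.
Qed.

(** The string consists of the weights 2l - k1 - k2, and t is twice a weight. For even t, the
    weights t/2 and t/2 + 1 have opposite parities, so at most one of them occurs, which produces
    the sign. *)
Lemma alternating_weights k1 k2 t :
  (k2 <= k1)%N ->
  \sum_(k2 <= l < k1.+1)
     ((l.*2 == (k1 + k2 - l).*2 + t)%N%:R - (l.*2 == (k1 + k2 - l).*2 + t.+2)%N%:R)
  = (if odd t then 0 else (alt_poly (k1 - k2))`_(t./2)) :> int.
Proof.
move=> k21; set d := (k1 - k2)%N; rewrite sumrB.
have shift u : \sum_(k2 <= l < k1.+1) (l.*2 == (k1 + k2 - l).*2 + u)%N%:R =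
    (~~ odd u && ~~ odd (d + u./2) && (u./2 <= d)%N)%:R :> int.
  rewrite -{1}[k2]add0n big_addn subSn // big_mkord -/d.
  have [odd_u|even_u] := boolP (odd u).
    by rewrite big1 // => i _; rewrite (_ : _ == _ = false) //; lia.
  rewrite (eq_bigr (fun i : 'I_d.+1 => (i.*2 == d + u./2)%N%:R)) => [|i _].
    rewrite sum_double_eq /=; congr (_%:R); rewrite ltnS.
    by case: (boolP (odd _)) => //= odd_d; congr nat_of_bool; lia.
  by congr (nat_of_bool _)%:R; have := ltn_ord i; lia.
rewrite !shift /= negbK; case: (boolP (odd t)) => odd_t /=; first by rewrite subrr.
rewrite coef_poly ltnS addnS /= negbK.
case: (leqP t./2 d) => td; last by rewrite (leq_gtF (ltnW td)) !andbF subrr.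
rewrite -signr_odd oddB //; case: (boolP (odd (d + t./2))) => [o|e].
  have -> : (t./2 < d)%N by lia.
  by rewrite oddD in o; rewrite o /= sub0r.
rewrite oddD in e; rewrite (negPf e) subr0 //.
Qed.

Lemma weight_difference s t :
  is_partition s -> (size s <= 3)%N ->
  \sum_(T : {ffun cell s -> 'I_3} | semistandard T)
     (((letter_count T 0).*2 == (letter_count T 1).*2 + t)%N%:R -
      ((letter_count T 0).*2 == (letter_count T 1).*2 + t.+2)%N%:R)
  = (if odd t then 0
     else (branch_poly (nth 0 s 0) (nth 0 s 1) (nth 0 s 2))`_(t./2)%N) :> int.
Proof.
move=> ps s3.
rewrite (sum_semistandard ps s3
  (fun a b => (a.*2 == b.*2 + t)%N%:R - (a.*2 == b.*2 + t.+2)%N%:R)).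
have -> : (if odd t then 0 else
    (branch_poly (nth 0 s 0) (nth 0 s 1) (nth 0 s 2))`_(t./2)%N) =
  \sum_(nth 0%N s 1 <= k1 < (nth 0%N s 0).+1)
    \sum_(nth 0%N s 2 <= k2 < (nth 0%N s 1).+1)
      (if odd t then 0 else (alt_poly (k1 - k2))`_(t./2)) :> int.
  case: odd; first by rewrite big1 // => k1 _; rewrite big1.
  rewrite /branch_poly coef_sum; apply: eq_bigr => k1 _.
  by rewrite coef_sum.
rewrite big_nat [RHS]big_nat; apply: eq_bigr => k1 /andP[k1l _].
rewrite big_nat [RHS]big_nat; apply: eq_bigr => k2 /andP[_ k2l].
by apply: alternating_weights; rewrite ltnS in k2l; apply: leq_trans k1l.
Qed.

(** A column of four cells needs four distinct letters. *)
Lemma semistandard_no_four_rows s (T : {ffun cell s -> 'I_3}) :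
  is_partition s -> (0 < nth 0 s 3)%N -> ~~ semistandard T.
Proof.
move=> ps s3; apply/negP => ssT.
have [c [cr _]] := cell_exists s3.
have := semistandard_row_leq ps c ssT; rewrite cr.
by have := ltn_ord (T c); lia.
Qed.

(** * Horizontal strips and the supersymmetric Schur function *)

Definition col_count (s : seq nat) (k : nat) : nat := count (fun p => k < p)%N s.

Lemma part_conj_part s k :
  is_partition s -> part (conj_part s) k.+1 = col_count s k.
Proof.
move=> ps; rewrite /part /conj_part /=.
have [k_lt|k_ge] := ltnP k (part s 1).
  by rewrite (nth_map 0%N) ?size_iota // nth_iota.
rewrite nth_default ?size_map ?size_iota //; apply/esym/eqP.
rewrite -leqn0 leqNgt -has_count; apply/hasPn => p ps'; rewrite -leqNgt.
apply: leq_trans k_ge; rewrite -(nth_index 0%N ps').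
exact: partition_nth_leq.
Qed.

Lemma size_conj_part s : size (conj_part s) = part s 1.
Proof. by rewrite size_map size_iota. Qed.

Lemma col_count_leq s j k : (j <= k)%N -> (col_count s k <= col_count s j)%N.
Proof. by move=> jk; apply: sub_count => p; apply: leq_ltn_trans. Qed.

Lemma conj_part_partition s : is_partition (conj_part s).
Proof.
rewrite /is_partition /conj_part sorted_map; apply: sub_sorted (iota_sorted 0 _).
by move=> j k jk; apply: col_count_leq.
Qed.

Lemma sumn_col_count s m :
  all (fun p => p <= m)%N s -> sumn s = (\sum_(k < m) col_count s k)%N.
Proof.
elim: s => [|p s IH] /=; first by rewrite big1.
move=> /andP[pm /IH ->]; rewrite big_split /=; congr (_ + _)%N.
rewrite -(subnKC pm) big_split_ord /= [X in (_ + X)%N]big1 ?addn0.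
  rewrite (eq_bigr (fun=> 1%N)) ?sum1_card ?card_ord // => i _.
  by rewrite ltn_ord.
by move=> i _; rewrite ltnNge leq_addr.
Qed.

Lemma partition_all_leq s : is_partition s -> all (fun p => p <= part s 1)%N s.
Proof.
move=> ps; apply/allP => p p_s; rewrite -(nth_index 0%N p_s).
exact: partition_nth_leq.
Qed.

Lemma sumn_conj_part s : is_partition s -> sumn (conj_part s) = sumn s.
Proof.
move=> ps; rewrite (sumn_col_count (partition_all_leq ps)) sumnE big_map.
have -> : iota 0 (part s 1) = index_iota 0 (part s 1) by rewrite /index_iota subn0.
by rewrite big_mkord.
Qed.

Lemma card_cell s : #|{: cell s}| = sumn s.
Proof.
rewrite -sum1_card (cell_sum s (fun _ _ => 1%N)).
rewrite (eq_bigr (fun i : 'I_(size s) => nth 0%N s i)); last first.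
  by move=> i _; rewrite sum1_card card_ord.
by rewrite sumnE (big_nth 0%N) big_mkord.
Qed.

Lemma horizontal_strip_part la nu i :
  horizontal_strip la nu -> (nth 0 nu i <= nth 0 la i)%N.
Proof.
case/andP=> /allP H _; have [i_lt|i_ge] := ltnP i (maxn (size la) (size nu)).
  by apply: (H i); rewrite mem_iota.
move: i_ge; rewrite geq_max => /andP[_ i_ge]; by rewrite nth_default.
Qed.

Lemma sumn_nth_leq (r s : seq nat) :
  (forall i, nth 0 r i <= nth 0 s i)%N -> (sumn r <= sumn s)%N.
Proof.
elim: r s => [//|p r IH] [|q s] H /=.
  have := H 0%N; rewrite /= leqn0 => /eqP ->; apply: (IH [::]) => i.
  by have := H i.+1; rewrite /= !nth_nil.
by apply: leq_add; [apply: (H 0%N)|apply: IH => i; apply: (H i.+1)].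
Qed.

Section Weights.
Variables (n : nat) (la : seq nat).

Definition tableau_weight (nu : seq nat) (T : {ffun cell (conj_part nu) -> 'I_n}) :
    'X_{1..n.+1} :=
  (U_(ord0) *+ (sumn la - sumn nu) +
   \sum_(c : cell (conj_part nu)) U_(lift ord0 (T c)))%MM.

Lemma tableau_weight0 nu (T : {ffun cell (conj_part nu) -> 'I_n}) :
  tableau_weight T ord0 = (sumn la - sumn nu)%N.
Proof.
rewrite mnmDE mulmnE mnm1E eqxx mul1n mnm_sumE big1 ?addn0 // => c _.
by rewrite mnm1E lift_eqF.
Qed.

Lemma tableau_weight_lift nu (T : {ffun cell (conj_part nu) -> 'I_n}) j :
  tableau_weight T (lift ord0 j) = #|[set c | T c == j]|.
Proof.
rewrite mnmDE mulmnE mnm1E eq_liftF mul0n add0n mnm_sumE.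
rewrite -sum1_card [RHS]big_mkcond; apply: eq_bigr => c _.
by rewrite mnm1E (inj_eq lift_inj) inE; case: eqP.
Qed.

Lemma mdeg_tableau_weight nu (T : {ffun cell (conj_part nu) -> 'I_n}) :
  is_partition nu -> horizontal_strip la nu -> mdeg (tableau_weight T) = sumn la.
Proof.
move=> pnu hs; rewrite mdegD mdegMn mdeg1 mul1n mdeg_sum.
rewrite (eq_bigr (fun=> 1%N)) => [|c _]; last exact: mdeg1.
rewrite sum1_card card_cell sumn_conj_part // subnK //.
by apply: sumn_nth_leq => i; apply: horizontal_strip_part.
Qed.

Lemma super_schur_polyE :
  super_schur_poly n la =
  \sum_(nu <- bounded_seqs la | is_partition nu && horizontal_strip la nu)
     \sum_(T : {ffun cell (conj_part nu) -> 'I_n} | semistandard T)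
       'X_[tableau_weight T].
Proof.
apply: eq_bigr => nu _; rewrite big_distrr; apply: eq_bigr => T _ /=.
rewrite mpolyXD -mpolyXn; congr (_ * _).
exact/esym/(big_morph _ (@mpolyXD _ _) (@mpolyX0 _ _)).
Qed.

Lemma super_schur_poly_sum b (cond : pred 'X_{1..n.+1}) :
  (sumn la < b)%N ->
  \sum_(mu : 'X_{1..n.+1 < b} | cond mu) (super_schur_poly n la)@_mu =
  \sum_(nu <- bounded_seqs la | is_partition nu && horizontal_strip la nu)
     \sum_(T : {ffun cell (conj_part nu) -> 'I_n} | semistandard T)
       (cond (tableau_weight T))%:R.
Proof.
move=> la_b; rewrite super_schur_polyE.
under eq_bigr do rewrite raddf_sum /=.
rewrite exchange_big /=; apply: eq_bigr => nu /andP[pnu hs].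
under eq_bigr do rewrite raddf_sum /=.
rewrite exchange_big /=; apply: eq_bigr => T _.
have w_b : (mdeg (tableau_weight T) < b)%N by rewrite mdeg_tableau_weight.
under eq_bigr do rewrite mcoeffX.
have [cw|ncw] := boolP (cond _).
  rewrite (bigD1 (BMultinom w_b)) //= eqxx big1 ?addr0 // => mu /andP[_].
  by rewrite -val_eqE eq_sym /= => /negPf ->.
rewrite big1 // => mu cmu; case: eqP => // e.
by rewrite e cmu in ncw.
Qed.

End Weights.

Lemma mem_bounded_seqs la x :
  (x \in bounded_seqs la) = (size x == size la) && all (fun p => p <= part la 1)%N x.
Proof.
apply/mapP/andP => [[t _ ->]|[/eqP sx /allP x_le]].
  rewrite size_map size_tuple eqxx; split=> //.
  by rewrite all_map; apply/allP => p _ /=; rewrite -ltnS ltn_ord.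
have st : size (map (@inord (part la 1)) x) == size la by rewrite size_map sx.
exists (Tuple st); first by rewrite mem_enum.
rewrite /= -map_comp map_id_in // => p /x_le p_le /=.
by rewrite inordK.
Qed.

Lemma uniq_bounded_seqs la : uniq (bounded_seqs la).
Proof.
rewrite map_inj_uniq ?enum_uniq // => t u tu.
by apply: val_inj; apply: (inj_map val_inj) tu.
Qed.

(** Both inequalities say that the diagram has a cell in row i and column k. *)
Lemma lt_col_count s k i :
  is_partition s -> (i < col_count s k)%N = (k < nth 0 s i)%N.
Proof.
elim: s i => [|p s IH] i ps; first by rewrite nth_nil.
have ps' : is_partition s by apply: path_sorted ps.
rewrite /col_count /= -/(col_count s k).
have [kp|pk] := ltnP k p; first by case: i => [|i] //=; rewrite add1n ltnS IH.
have /eqP -> : col_count s k == 0%N.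
  rewrite -leqn0 leqNgt IH // -leqNgt; apply: leq_trans pk.
  exact: (@partition_nth_leq (p :: s) ps 0 1).
rewrite ltn0; apply/esym/negbTE; rewrite -leqNgt; apply: leq_trans pk.
exact: (@partition_nth_leq (p :: s) ps 0 i).
Qed.

Lemma col_count_nth_leq (r s : seq nat) k :
  is_partition r -> is_partition s ->
  (forall i, nth 0 r i <= nth 0 s i)%N -> (col_count r k <= col_count s k)%N.
Proof.
move=> pr ps rs; rewrite leqNgt; apply/negP; rewrite lt_col_count // => lt.
have := leq_trans lt (rs _); rewrite -lt_col_count //.
by rewrite ltnn.
Qed.

Lemma strip_col_count la nu k :
  is_partition la -> is_partition nu -> horizontal_strip la nu ->
  (col_count nu k <= col_count la k <= (col_count nu k).+1)%N.
Proof.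
move=> pla pnu hs; rewrite col_count_nth_leq //=; last first.
  by move=> i; apply: horizontal_strip_part.
have [k_lt|k_ge] := ltnP k (part la 1); last first.
  by rewrite leqNgt lt_col_count // -leqNgt
    (leq_trans (partition_nth_leq pla (leq0n _))) // (leq_trans k_ge).
case/andP: hs => _ /allP/(_ k); rewrite mem_iota !part_conj_part // => /(_ k_lt).
by rewrite leq_subLR addn1.
Qed.

Section StripBijection.
Variable la : seq nat.
Hypotheses (pla : is_partition la) (la2 : (part la 2 <= 3)%N).
Local Notation c := (col_count la).

(** Since the second part is at most 3, only the first row reaches beyond the third column. *)
Lemma col_count_ge3 k : (3 <= k)%N -> c k = (k < part la 1)%N.
Proof.
move=> k3; have c1 : (c k <= 1)%N.
  by rewrite leqNgt lt_col_count // -leqNgt; apply: leq_trans k3.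
by have := lt_col_count k 0 pla; rewrite /part /=; case: (c k) c1 => [|[|?]] //= _ <-.
Qed.

Lemma sumn_three_columns : sumn la = (c 0 + c 1 + c 2 + (part la 1 - 3))%N.
Proof.
have all_le : all (fun p => p <= 3 + (part la 1 - 3))%N la.
  apply: sub_all (partition_all_leq pla) => p /=; lia.
rewrite (sumn_col_count all_le) big_split_ord /= !big_ord_recl big_ord0 /=.
rewrite addn0 !addnA; congr (_ + _)%N.
rewrite (eq_bigr (fun=> 1%N)) ?sum1_card ?card_ord // => i _.
rewrite col_count_ge3 ?leq_addr //; have := ltn_ord i; lia.
Qed.

Lemma sumn_narrow nu : is_partition nu -> (part nu 1 <= 3)%N ->
  sumn nu = (col_count nu 0 + col_count nu 1 + col_count nu 2)%N.
Proof.
move=> pnu nu1; have all_le : all (fun p => p <= 3)%N nu.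
  by apply: sub_all (partition_all_leq pnu) => p /= /leq_trans; apply.
by rewrite (sumn_col_count all_le) !big_ord_recl big_ord0 /= addn0 !addnA.
Qed.

(** Padded with zeros to the length of [la], as are the members of [bounded_seqs la]. *)
Definition columns_seq (a0 a1 a2 : nat) : seq nat :=
  mkseq (fun i => (i < a0) + (i < a1) + (i < a2))%N (size la).

Lemma eq_from_ltn m m' : (forall i, (i < m)%N = (i < m')%N) -> m = m'.
Proof.
move=> e; apply/eqP; rewrite eqn_leq leqNgt e ltnn leqNgt.
by rewrite -e ltnn.
Qed.

Lemma narrow_columns_seq nu : is_partition nu -> (part nu 1 <= 3)%N ->
  size nu = size la ->
  nu = columns_seq (col_count nu 0) (col_count nu 1) (col_count nu 2).
Proof.
move=> pnu nu1 snu; apply: (@eq_from_nth _ 0%N); first by rewrite size_mkseq.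
move=> i i_lt; rewrite nth_mkseq -?snu // !lt_col_count //.
have : (nth 0 nu i <= 3)%N by apply: leq_trans nu1; apply: partition_nth_leq.
by case: (nth 0%N nu i) => [|[|[|[|]]]].
Qed.

Lemma columns_seqP a0 a1 a2 (nu := columns_seq a0 a1 a2) :
  (a2 <= a1 <= a0)%N -> (a0 <= c 0 <= a0.+1)%N -> (a1 <= c 1 <= a1.+1)%N ->
  (a2 <= c 2 <= a2.+1)%N ->
  [/\ nu \in bounded_seqs la, is_partition nu, horizontal_strip la nu,
      (part nu 1 <= 3)%N
    & [/\ col_count nu 0 = a0, col_count nu 1 = a1 & col_count nu 2 = a2]].
Proof.
move=> /andP[a21 a10] /andP[c0 c0'] /andP[c1 c1'] /andP[c2 c2'].
have a0_le : (a0 <= size la)%N by apply: leq_trans c0 (count_size _ _).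
have nuE i : nth 0%N nu i = ((i < a0) + (i < a1) + (i < a2))%N.
  have [i_lt|i_ge] := ltnP i (size la); first by rewrite nth_mkseq.
  by rewrite nth_default ?size_mkseq //; lia.
have pnu : is_partition nu.
  rewrite /is_partition sorted_map; apply: sub_sorted (iota_sorted 0 _).
  by move=> i j ij /=; rewrite /geq /=; lia.
have nu_le i : (nth 0 nu i <= nth 0 la i)%N.
  have h0 := lt_col_count 0 i pla; have h1 := lt_col_count 1 i pla.
  have h2 := lt_col_count 2 i pla; rewrite nuE; lia.
have cols k : col_count nu k = if k is k'.+1 then if k' is k''.+1 then
    if k'' is _.+1 then 0%N else a2 else a1 else a0.
  apply: eq_from_ltn => i; rewrite lt_col_count // nuE.
  by case: k => [|[|[|k]]]; lia.
split=> //.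
- rewrite mem_bounded_seqs size_mkseq eqxx; apply/(all_nthP 0%N) => i _.
  by apply: leq_trans (nu_le i) _; apply: partition_nth_leq.
- apply/andP; split; apply/allP => k _; first exact: nu_le.
  rewrite !part_conj_part // cols leq_subLR.
  case: k => [|[|[|k]]]; rewrite ?addn1 //.
  by rewrite col_count_ge3 // leq_b1.
- by rewrite /part nuE; lia.
by rewrite !cols.
Qed.

(* Removing a horizontal strip that leaves at most three columns amounts to
   choosing which of the first three columns lose a box; a choice that does not
   leave a partition contributes 0. *)
Lemma strip_sum (A : zmodType) (Phi : nat -> nat -> nat -> A) :
  (forall a0 a1 a2, ~~ (a2 <= a1 <= a0)%N -> Phi a0 a1 a2 = 0) ->
  \sum_(nu <- bounded_seqs la | (is_partition nu && horizontal_strip la nu)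
                                && (part nu 1 <= 3)%N)
     Phi (col_count nu 0) (col_count nu 1) (col_count nu 2) =
  \sum_(e : bool * bool * bool | [&& e.1.1 <= c 0, e.1.2 <= c 1 & e.2 <= c 2]%N)
     Phi (c 0 - e.1.1)%N (c 1 - e.1.2)%N (c 2 - e.2)%N.
Proof.
(* [p nu] records which columns lose a box. As [nu] has at most three columns, each fibre of [p] has
   at most one element. *)
move=> Phi0; pose p nu := (col_count nu 0 != c 0, col_count nu 1 != c 1,
                           col_count nu 2 != c 2).
pose Q (e : bool * bool * bool) := [&& e.1.1 <= c 0, e.1.2 <= c 1 & e.2 <= c 2]%N.
rewrite (partition_big p Q) => [|nu /andP[/andP[pnu hs] _]]; last first.
  have s0 := strip_col_count 0 pla pnu hs; have s1 := strip_col_count 1 pla pnu hs.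
  have s2 := strip_col_count 2 pla pnu hs; rewrite /Q /p /=; lia.
apply: eq_bigr => -[[e0 e1] e2] /and3P[/= e0c e1c e2c].
have eP nu : is_partition nu -> horizontal_strip la nu ->
    p nu == (e0, e1, e2) ->
    [/\ col_count nu 0 = c 0 - e0, col_count nu 1 = c 1 - e1
      & col_count nu 2 = c 2 - e2]%N.
  move=> pnu hs /eqP[q0 q1 q2].
  have s0 := strip_col_count 0 pla pnu hs; have s1 := strip_col_count 1 pla pnu hs.
  have s2 := strip_col_count 2 pla pnu hs.
  by split; [move: q0|move: q1|move: q2]; case: eqP => h <-; lia.
have [chain|nchain] := boolP (c 2 - e2 <= c 1 - e1 <= c 0 - e0)%N; last first.
  rewrite Phi0 // big1 // => nu /andP[/andP[/andP[pnu hs] _] pe].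
  by have [-> -> ->] := eP nu pnu hs pe; rewrite Phi0.
have bound x (e : bool) : (e <= x)%N -> (x - e <= x <= (x - e).+1)%N.
  by case: e => /=; lia.
have := columns_seqP chain (bound _ _ e0c) (bound _ _ e1c) (bound _ _ e2c).
set nu0 := columns_seq _ _ _ => -[nu0_mem pnu0 hs0 nu01 [n0 n1 n2]].
rewrite big_seq_cond (eq_bigl (fun nu => (nu \in bounded_seqs la) && (nu == nu0))).
  rewrite -big_seq_cond big_mkcond (bigD1_seq nu0) ?uniq_bounded_seqs //= eqxx.
  by rewrite n0 n1 n2 big1 ?addr0 // => nu /negPf ->.
move=> nu; apply: andb_id2l; rewrite mem_bounded_seqs => /andP[/eqP snu _].
apply/andP/eqP => [[/andP[/andP[pnu hs] nu1] pe]|->].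
  have [h0 h1 h2] := eP nu pnu hs pe.
  by rewrite (narrow_columns_seq pnu nu1 snu) h0 h1 h2.
rewrite pnu0 hs0 nu01; split=> //; rewrite /p n0 n1 n2; apply/eqP.
have ne x (e : bool) : (e <= x)%N -> (x - e != x)%N = e.
  by case: e => /=; lia.
by rewrite !ne.
Qed.

End StripBijection.

(** * The generating function *)

Section SeriesCoefficients.
Variables (A : comNzRingType) (k : nat).
Implicit Types (p q : {mpoly A[k]}) (m : 'X_{1..k}) (F G : nat -> nat -> nat -> A).

(* The i-th variable, counted from 0, and 0 if there are only i or fewer. *)
Definition series_var (i : nat) : {mpoly A[k]} :=
  if insub i is Some j then 'X_(j : 'I_k) else 0.

Definition exponent m (i : nat) : nat :=
  if insub i is Some j then m (j : 'I_k) else 0%N.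

Definition series_of F m : A := F (exponent m 0) (exponent m 1) (exponent m 2).

(** A series is given by its coefficient function, whereas [{mpoly A[k]}] has only polynomials.
    Comparing them below a degree [d] is enough for each single coefficient. *)
Definition agrees (d : nat) p F : Prop :=
  forall m, (mdeg m < d)%N -> p@_m = series_of F m.

Definition truncation (d : nat) F : {mpoly A[k]} :=
  \sum_(h : 'X_{1..k < d}) series_of F h *: 'X_[h].

(** The effect on coefficients of multiplying a series by the variable of the same index. *)
Definition shift0 F l0 l1 l2 := if l0 is l.+1 then F l l1 l2 else 0 : A.
Definition shift1 F l0 l1 l2 := if l1 is l.+1 then F l0 l l2 else 0 : A.
Definition shift2 F l0 l1 l2 := if l2 is l.+1 then F l0 l1 l else 0 : A.

Lemma truncation_agrees d F : agrees d (truncation d F) F.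
Proof.
move=> m md; rewrite /truncation raddf_sum /= (bigD1 (BMultinom md)) //= big1.
  by rewrite addr0 mcoeffZ mcoeffX eqxx mulr1.
by move=> h; rewrite -val_eqE /= mcoeffZ mcoeffX => /negPf ->; rewrite mulr0.
Qed.

Lemma agrees_eq d p F G :
  (forall l0 l1 l2, F l0 l1 l2 = G l0 l1 l2) -> agrees d p F -> agrees d p G.
Proof. by move=> FG pF m md; rewrite pF // /series_of FG. Qed.

Lemma agreesD d p q F G : agrees d p F -> agrees d q G ->
  agrees d (p + q) (fun l0 l1 l2 => F l0 l1 l2 + G l0 l1 l2).
Proof. by move=> pF qG m md; rewrite mcoeffD pF ?qG. Qed.

Lemma agreesB d p q F G : agrees d p F -> agrees d q G ->
  agrees d (p - q) (fun l0 l1 l2 => F l0 l1 l2 - G l0 l1 l2).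
Proof. by move=> pF qG m md; rewrite mcoeffB pF ?qG. Qed.

Lemma agreesC d p F (a : A) : agrees d p F ->
  agrees d (a%:MP * p) (fun l0 l1 l2 => a * F l0 l1 l2).
Proof. by move=> pF m md; rewrite mcoeffCM pF. Qed.

Lemma mcoeff_mulX p (j : 'I_k) m :
  ('X_j * p)@_m = if (0 < m j)%N then p@_(m - U_(j))%MM else 0.
Proof.
have [mj|mj] := posnP (m j).
  rewrite mcoeffM big1 // => h /eqP mh; rewrite mcoeffX.
  case: eqP => [e|_]; last by rewrite mul0r.
  have := congr1 (fun m' : 'X_{1..k} => m' j) mh.
  by rewrite mj mnmDE -e mnm1E eqxx.
have {1}-> : m = (U_(j) + (m - U_(j)))%MM.
  apply/mnmP => i; rewrite mnmDE mnmBE mnm1E; case: eqP => [<-|_].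
    by rewrite subnKC.
  by rewrite subn0.
by rewrite mulrC mcoeffMX.
Qed.

(** Absent variables are covered too: for i >= k both the i-th variable and [exponent m i] are 0,
    and the latter selects the branch 0. *)
Lemma agrees_var i (S : (nat -> nat -> nat -> A) -> nat -> nat -> nat -> A) d p F :
  (forall m, series_of (S F) m =
     if (0 < exponent m i)%N
     then F (exponent m 0 - (i == 0))%N (exponent m 1 - (i == 1))%N
            (exponent m 2 - (i == 2))%N
     else 0) ->
  agrees d p F -> agrees d (series_var i * p) (S F).
Proof.
move=> SE pF m md; rewrite SE /series_var {1}/exponent.
case: insubP => [j _ ji|_]; last by rewrite mul0r mcoeff0.
rewrite mcoeff_mulX; case: ifP => // mj; rewrite pF; last first.
  by apply: leq_ltn_trans md; apply: mdegB.
have exp i' : exponent (m - U_(j))%MM i' = (exponent m i' - (i == i'))%N.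
  rewrite /exponent; case: insubP => [j' _ ji'|_] //.
  by rewrite mnmBE mnm1E -ji -ji' (inj_eq val_inj).
by rewrite /series_of !exp.
Qed.

Lemma agrees_var0 d p F : agrees d p F -> agrees d (series_var 0 * p) (shift0 F).
Proof.
apply: agrees_var => m; rewrite /series_of /shift0 /= !subn0.
by case: exponent => //= l; rewrite subn1.
Qed.

Lemma agrees_var1 d p F : agrees d p F -> agrees d (series_var 1 * p) (shift1 F).
Proof.
apply: agrees_var => m; rewrite /series_of /shift1 /= !subn0.
by case: (exponent m 1) => //= l; rewrite subn1.
Qed.

Lemma agrees_var2 d p F : agrees d p F -> agrees d (series_var 2 * p) (shift2 F).
Proof.
apply: agrees_var => m; rewrite /series_of /shift2 /= !subn0.
by case: (exponent m 2) => //= l; rewrite subn1.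
Qed.

Lemma agrees_mul d p q q' F : agrees d q F -> agrees d q' F ->
  forall m, (mdeg m < d)%N -> (p * q)@_m = (p * q')@_m.
Proof.
move=> qF qF' m md; rewrite !mcoeffM; apply: eq_bigr => h /eqP mh.
congr (_ * _); have h2 : (mdeg h.2 < d)%N.
  by apply: leq_ltn_trans md; rewrite [X in (_ <= X)%N](congr1 mdeg mh) mdegD leq_addl.
by rewrite qF ?qF'.
Qed.

Lemma is_expansion_truncation (P Q : {mpoly A[k]}) F :
  (forall m, (Q * truncation (mdeg m).+1 F)@_m = P@_m) ->
  is_expansion P Q (series_of F).
Proof.
move=> QF m; rewrite -QF mcoeffM; apply: eq_bigr => h /eqP mh; congr (_ * _).
by rewrite truncation_agrees // ltnS [X in (_ <= X)%N](congr1 mdeg mh) mdegD leq_addl.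
Qed.

End SeriesCoefficients.

(** * Branching from u(3) to so(3) as a rational function *)

Section BranchingSeries.
Variables (A : comNzRingType) (J z : A) (alt : nat -> A).
(** The two equations determine [alt]: where J + 1 is invertible, alt d = (J^(d+1) + (-1)^d) / (J +
    1). *)
Hypothesis alt0 : alt 0 = 1.
Hypothesis altS : forall d, alt d.+1 + alt d = J ^+ d.+1.

Definition branching l0 l1 l2 : A :=
  \sum_(l1 <= k1 < l0.+1) \sum_(l2 <= k2 < l1.+1) alt (k1 - k2).

(* Two-row partitions in the coordinates p = l0 - l1, q = l1, in which A1 shifts
   p and A1 A2 shifts q. *)
Definition strict_part (f : nat -> nat -> A) l0 l1 l2 : A :=
  if (l2 == 0)%N && (l1 <= l0)%N then f (l0 - l1)%N l1 else 0.

(** With k1 = l1 + a and k2 = l1 - c, the pairs (k1, k2) for l2 = 0 become the points of the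
    rectangle a <= p, c <= q, and k1 - k2 = a + c. *)
Let row x q := \sum_(c < q.+1) alt (x + c).
Let power_row x q := \sum_(c < q.+1) J ^+ (x + c).
Let rect p q := \sum_(a < p.+1) row a q.

Let branching_rect l0 l1 : (l1 <= l0)%N -> branching l0 l1 0 = rect (l0 - l1) l1.
Proof.
move=> l10; rewrite /branching -{1}[l1]add0n big_addn subSn // big_mkord.
apply: eq_bigr => a _; rewrite big_nat_rev big_mkord; apply: eq_bigr => c _.
by congr (alt _); have := ltn_ord c; lia.
Qed.

(** The summands depend on k1 - k2 only, so a common shift of l0, l1, l2 cancels and only l2 = 0
    survives the factor 1 - A1 A2 A3. *)
Lemma branching_diff l0 l1 l2 :
  branching l0 l1 l2 - shift0 (shift1 (shift2 branching)) l0 l1 l2 =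
  strict_part rect l0 l1 l2.
Proof.
rewrite /shift0 /shift1 /shift2 /strict_part.
case: l2 => [|l2] /=.
  have -> : (if l0 is l.+1 then if l1 is l'.+1 then 0 else 0 else 0) = 0 :> A.
    by case: l0 => // l; case: l1.
  rewrite subr0; case: leqP => l01; first by rewrite branching_rect.
  by rewrite /branching big_geq.
case: l0 => [|l0].
  rewrite subr0 /branching; case: l1 => [|l1]; last by rewrite big_geq.
  by rewrite big_nat1 big_geq.
case: l1 => [|l1].
  rewrite subr0 /branching big1 // => k1 _; by rewrite big_geq.
rewrite /branching big_add1 /=; apply/eqP; rewrite subr_eq0; apply/eqP.
by apply: eq_bigr => k1 _; rewrite big_add1 /=; apply: eq_bigr => k2 _; rewrite subSS.
Qed.

Let shiftp (f : nat -> nat -> A) p q := if p is p'.+1 then f p' q else 0.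
Let shiftq (f : nat -> nat -> A) p q := if q is q'.+1 then f p q' else 0.

Lemma shift0_strict f l0 l1 l2 :
  shift0 (strict_part f) l0 l1 l2 = strict_part (shiftp f) l0 l1 l2.
Proof.
rewrite /shift0 /strict_part; case: l0 => [|l0].
  by case: l2 => //=; case: l1.
case: l2 => //=; case: (ltngtP l1 l0.+1) => [l10|l10|->].
- by rewrite -ltnS l10 subSn // -ltnS.
- by rewrite leqNgt (ltn_trans (ltnSn l0) l10).
by rewrite ltnn subnn.
Qed.

Lemma shift01_strict f l0 l1 l2 :
  shift0 (shift1 (strict_part f)) l0 l1 l2 = strict_part (shiftq f) l0 l1 l2.
Proof.
rewrite /shift0 /shift1 /strict_part; case: l0 l1 => [|l0] [|l1] //=;
  by case: l2.
Qed.

(* What is left of the series after multiplying it in turn by 1 - A1^2,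
   1 - A1^2 A2^2, 1 - A1 J and 1 - A1 A2 J. *)
Let g2 p q := if p is p'.+1 then power_row p q else row 0 q.
Let g3 p q : A := J ^+ (p + q) + (if ((0 < p) && (0 < q))%N then J ^+ (p + q).-1 else 0).
Let g4 p q : A := if p is p'.+1 then
  if p' is _.+1 then 0 else if q is _.+1 then J ^+ q else 0 else J ^+ q.
Let g5 p q : A := ((p == 0) && (q == 0))%N%:R + J * ((p == 1) && (q == 1))%N%:R.

(** The two rows that survive the factor 1 - A1^2 pair up by [altS], which replaces alternating
    terms by powers of J. *)
Let power_rowE x q : row x.+1 q + row x q = power_row x.+1 q.
Proof.
rewrite /row -big_split; apply: eq_bigr => c _ /=.
by rewrite addSn altS.
Qed.

Let row0 x : row x 0 = alt x.
Proof. by rewrite /row big_ord1 addn0. Qed.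

Let rowS x q : row x q.+1 = row x q + alt (x + q.+1).
Proof. by rewrite /row big_ord_recr. Qed.

Let power_row0 x : power_row x 0 = J ^+ x.
Proof. by rewrite /power_row big_ord1 addn0. Qed.

Let power_rowS x q : power_row x q.+1 = power_row x q + J ^+ (x + q.+1).
Proof. by rewrite /power_row big_ord_recr. Qed.

Let rect0 q : rect 0 q = row 0 q.
Proof. by rewrite /rect big_ord1. Qed.

Let rectS p q : rect p.+1 q = rect p q + row p.+1 q.
Proof. by rewrite /rect big_ord_recr. Qed.

Let addrAK (a b c : A) : a + b + c - a = c + b.
Proof. by ring. Qed.

Let g2E p q : rect p q - shiftp (shiftp rect) p q = g2 p q.
Proof.
case: p => [|[|p]]; rewrite /shiftp /g2.
- by rewrite subr0 rect0.
- by rewrite subr0 rectS rect0 addrC power_rowE.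
by rewrite !rectS addrAK power_rowE.
Qed.

(** The last two terms of a row survive: for p = 0 they pair up by [altS], for p > 0 they already
    are powers of J. *)
Let g3E p q : g2 p q - shiftq (shiftq g2) p q = g3 p q.
Proof.
case: p q => [|p] [|[|q]]; rewrite /shiftq /g2 /g3 ?andbF ?addr0 ?subr0.
- by rewrite row0 alt0.
- by rewrite rowS row0 addrC altS ?addr0.
- by rewrite !rowS addrAK !add0n altS ?addr0.
- by rewrite power_row0 addn0.
- by rewrite power_rowS power_row0 addrC addn1.
by rewrite !power_rowS addrAK !addnS.
Qed.

Let g4E p q : g3 p q - J * shiftp g3 p q = g4 p q.
Proof.
by case: p q => [|[|p]] [|q];
  rewrite /g3 /g4 /= ?add0n ?addn0 ?addSn ?addnS /= ?exprS ?expr0; ring.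
Qed.

Let g5E p q : g4 p q - J * shiftq g4 p q = g5 p q.
Proof.
by case: p q => [|[|p]] [|[|q]]; rewrite /g4 /g5 /= ?exprS ?expr0; ring.
Qed.

Lemma strict_partB f g l0 l1 l2 : strict_part f l0 l1 l2 - strict_part g l0 l1 l2 =
  strict_part (fun p q => f p q - g p q) l0 l1 l2.
Proof. by rewrite /strict_part; case: ifP => _; rewrite ?subr0. Qed.

Lemma strict_partZ (a : A) f l0 l1 l2 : a * strict_part f l0 l1 l2 =
  strict_part (fun p q => a * f p q) l0 l1 l2.
Proof. by rewrite /strict_part; case: ifP => _; rewrite ?mulr0. Qed.

Lemma strict_part_eq f g : f =2 g -> forall l0 l1 l2,
  strict_part f l0 l1 l2 = strict_part g l0 l1 l2.
Proof. by move=> fg l0 l1 l2; rewrite /strict_part fg. Qed.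

(** Multiplication by a factor 1 + A_i z: the corresponding column may lose a box, marked by z. *)
Definition remove0 F l0 l1 l2 : A := F l0 l1 l2 + z * shift0 F l0 l1 l2.
Definition remove1 F l0 l1 l2 : A := F l0 l1 l2 + z * shift1 F l0 l1 l2.
Definition remove2 F l0 l1 l2 : A := F l0 l1 l2 + z * shift2 F l0 l1 l2.

Section Expansion.
Variable k : nat.
Hypothesis k_le3 : (k <= 3)%N.

Local Notation A1 := (series_var A k 0).
Local Notation A2 := (series_var A k 1).
Local Notation A3 := (series_var A k 2).

Let agrees_strict0 d (p : {mpoly A[k]}) f : agrees d p (strict_part f) ->
  agrees d (A1 * p) (strict_part (shiftp f)).
Proof. by move/agrees_var0; apply: agrees_eq => *; apply: shift0_strict. Qed.

Let agrees_strict01 d (p : {mpoly A[k]}) f : agrees d p (strict_part f) ->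
  agrees d (A1 * (A2 * p)) (strict_part (shiftq f)).
Proof.
by move/agrees_var1/agrees_var0; apply: agrees_eq => *; apply: shift01_strict.
Qed.

Let agrees_strictB d (p q : {mpoly A[k]}) f g h : f =2 (fun x y => g x y - h x y) ->
  agrees d p (strict_part g) -> agrees d q (strict_part h) ->
  agrees d (p - q) (strict_part f).
Proof.
move=> fgh pg qh; apply: agrees_eq (agreesB pg qh) => l0 l1 l2.
by rewrite strict_partB; apply: strict_part_eq => x y; rewrite fgh.
Qed.

Let agrees_strictZ d (p : {mpoly A[k]}) f (a : A) : agrees d p (strict_part f) ->
  agrees d (a%:MP * p) (strict_part (fun x y => a * f x y)).
Proof. by move/(agreesC a); apply: agrees_eq => *; apply: strict_partZ. Qed.

Let agrees_one d :
  agrees d (1 : {mpoly A[k]}) (strict_part (fun p q => ((p == 0) && (q == 0))%N%:R)).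
Proof.
move=> m _; rewrite mcoeff1 /series_of /strict_part.
have -> : (m == 0%MM) = [&& exponent m 0 == 0, exponent m 1 == 0
                          & exponent m 2 == 0]%N.
  apply/eqP/and3P => [->|[/eqP e0 /eqP e1 /eqP e2]].
    by split; rewrite /exponent; case: insub => // j; rewrite mnm0E.
  apply/mnmP => j; rewrite mnm0E; have jk := ltn_ord j.
  have : exponent m j = m j by rewrite /exponent valK.
  have : (j < 3)%N by apply: leq_trans jk k_le3.
  by case: (nat_of_ord j) => [|[|[|]]] // _ <-.
case: (exponent m 2) => [|l2] /=; last by rewrite !andbF.
case: (exponent m 1) => [|l1] /=; last by rewrite !andbF; case: ifP.
by rewrite subn0 andbT.
Qed.

Let agrees_num d :
  agrees d (1 + A1 ^+ 2 * A2 * J%:MP) (strict_part g5).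
Proof.
have -> : A1 ^+ 2 * A2 * J%:MP = J%:MP * (A1 * (A1 * (A2 * 1))) by ring.
have one := @agrees_one d.
have := agreesD one (agrees_strictZ J (agrees_strict0 (agrees_strict01 one))).
apply: agrees_eq => l0 l1 l2; rewrite /strict_part.
case: ifP => _; last by rewrite addr0.
congr (_ + J * _); move: (l0 - l1)%N => p.
by case: p l1 => [|[|p]] [|[|q]].
Qed.

(** Multiplies by the factors of the denominator in the order in which the coefficients simplify;
    the quadratic factors come before those with J because they remove the signs. *)
Let den_chain (B : comNzRingType) (a1 a2 a3 x y t : B) :
  let t1 := t - a1 * (a2 * (a3 * t)) in
  let t2 := t1 - a1 * (a1 * t1) in
  let t3 := t2 - a1 * (a2 * (a1 * (a2 * t2))) in
  let t4 := t3 - y * (a1 * t3) in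
  gf_den a1 a2 a3 x y * t = t4 - y * (a1 * (a2 * t4)).
Proof. by rewrite /gf_den /=; ring. Qed.

Let agrees_den d (p : {mpoly A[k]}) : agrees d p branching ->
  agrees d (gf_den A1 A2 A3 z%:MP J%:MP * p) (strict_part g5).
Proof.
move=> p0; rewrite den_chain.
have p1 : agrees d (p - A1 * (A2 * (A3 * p))) (strict_part rect).
  apply: agrees_eq (agreesB p0 (agrees_var0 (agrees_var1 (agrees_var2 p0)))).
  exact: branching_diff.
move: (_ - _) p1 => t1 p1.
have p2 : agrees d (t1 - A1 * (A1 * t1)) (strict_part g2).
  apply: agrees_strictB p1 (agrees_strict0 (agrees_strict0 p1)) => x y.
  by rewrite -g2E.
move: (_ - _) p2 => t2 p2.
have p3 : agrees d (t2 - A1 * (A2 * (A1 * (A2 * t2)))) (strict_part g3).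
  apply: agrees_strictB p2 (agrees_strict01 (agrees_strict01 p2)) => x y.
  by rewrite -g3E.
move: (_ - _) p3 => t3 p3.
have p4 : agrees d (t3 - J%:MP * (A1 * t3)) (strict_part g4).
  apply: agrees_strictB p3 (agrees_strictZ J (agrees_strict0 p3)) => x y.
  by rewrite -g4E.
move: (_ - _) p4 => t4 p4.
apply: agrees_strictB p4 (agrees_strictZ J (agrees_strict01 p4)) => x y.
by rewrite -g5E.
Qed.

Let num_split (B : comNzRingType) (a1 a2 a3 x D t : B) :
  D * ((1 + a1 * x) * ((1 + a2 * x) * ((1 + a3 * x) * t))) =
  (1 + a1 * x) * (1 + a2 * x) * (1 + a3 * x) * (D * t).
Proof. by ring. Qed.

Let addz (B : comNzRingType) (a x t : B) : (1 + a * x) * t = t + x * (a * t).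
Proof. by ring. Qed.

Lemma branching_expansion :
  is_expansion (gf_num A1 A2 A3 z%:MP J%:MP) (gf_den A1 A2 A3 z%:MP J%:MP)
               (series_of (remove0 (remove1 (remove2 branching)))).
Proof.
apply: is_expansion_truncation => m; set d := (mdeg m).+1.
have md : (mdeg m < d)%N by [].
have := @truncation_agrees A k d branching; set T0 := truncation _ _ _ => t0.
have t3 : agrees d ((1 + A1 * z%:MP) * ((1 + A2 * z%:MP) * ((1 + A3 * z%:MP) * T0)))
    (remove0 (remove1 (remove2 branching))).
  have a2 : agrees d ((1 + A3 * z%:MP) * T0) (remove2 branching).
    by rewrite addz; apply: agreesD => //; apply/agreesC/agrees_var2.
  have a1 : agrees d ((1 + A2 * z%:MP) * ((1 + A3 * z%:MP) * T0))
      (remove1 (remove2 branching)).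
    by rewrite addz; apply: agreesD => //; apply/agreesC/agrees_var1.
  by rewrite addz; apply: agreesD => //; apply/agreesC/agrees_var0.
(* Below degree [d] the truncation may be replaced by the explicit product, whose factors 1 + A_i z
   commute past the denominator. *)
rewrite (agrees_mul _ (@truncation_agrees A k d _) t3 md) num_split /gf_num.
exact: (agrees_mul _ (agrees_den t0) (@agrees_num d) md).
Qed.

End Expansion.
End BranchingSeries.

Lemma alt_polyS d : alt_poly d.+1 + alt_poly d = 'X^(d.+1).
Proof.
apply/polyP => j; rewrite coefD !coef_poly coefXn !ltnS.
case: (ltngtP j d.+1) => [jd|dj|->].
- have jd' : (j <= d)%N by [].
  by rewrite jd' subSn // exprS mulN1r addNr.
- by rewrite leqNgt (ltn_trans (ltnSn d) dj) addr0.
by rewrite ltnn subnn addr0.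
Qed.

Lemma alt_poly0 : alt_poly 0 = 1.
Proof. by apply/polyP => j; rewrite coef_poly coef1; case: j. Qed.

Lemma branch_poly_strict l0 l1 l2 :
  ~~ (l2 <= l1 <= l0)%N -> branch_poly l0 l1 l2 = 0.
Proof.
rewrite negb_and -!ltnNge /branch_poly => /orP[l12|l01]; last by rewrite big_geq.
by rewrite big1 // => k1 _; rewrite big_geq.
Qed.

Lemma branching_polyC l0 l1 l2 :
  branching (fun d => (alt_poly d)%:P) l0 l1 l2 = (branch_poly l0 l1 l2)%:P.
Proof.
rewrite /branching /branch_poly rmorph_sum; apply: eq_bigr => k1 _.
by rewrite rmorph_sum.
Qed.

Lemma big_bool3 (B : nmodType) (F : bool * bool * bool -> B) (P : pred _) :
  \sum_(e | P e) F e =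
  \sum_(a : bool) \sum_(b : bool) \sum_(c : bool)
     (if P (a, b, c) then F (a, b, c) else 0).
Proof.
rewrite big_mkcond pair_bigA pair_bigA /=.
by apply: eq_bigr => -[[a b] c].
Qed.

Lemma remove_expand (B : comNzRingType) (z : B) F l0 l1 l2 :
  remove0 z (remove1 z (remove2 z F)) l0 l1 l2 =
  \sum_(e : bool * bool * bool | [&& e.1.1 <= l0, e.1.2 <= l1 & e.2 <= l2]%N)
     z ^+ (e.1.1 + e.1.2 + e.2) * F (l0 - e.1.1)%N (l1 - e.1.2)%N (l2 - e.2)%N.
Proof.
rewrite big_bool3 !big_bool /remove0 /remove1 /remove2 /shift0 /shift1 /shift2.
case: l0 l1 l2 => [|l0] [|l1] [|l2] /=; rewrite ?subn0 ?subn1 /=; ring.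
Qed.

(** For k < 3 the columns from k on are empty, which matches the exponent 0 read for absent
    variables. *)
Lemma gf_coefE k la :
  (k <= 3)%N -> (forall i, (k <= i < 3)%N -> col_count la i = 0%N) ->
  is_partition la ->
  gf_coef k la =
  \sum_(e : bool * bool * bool | [&& e.1.1 <= col_count la 0,
           e.1.2 <= col_count la 1 & e.2 <= col_count la 2]%N)
     'X ^+ (e.1.1 + e.1.2 + e.2) *
     (branch_poly (col_count la 0 - e.1.1)
        (col_count la 1 - e.1.2) (col_count la 2 - e.2))%:P.
Proof.
move=> k3 cols pla.
pose alt d : polyzJ := (alt_poly d)%:P.
have alt0 : alt 0%N = 1 by rewrite /alt alt_poly0.
have altS d : alt d.+1 + alt d = ('X%:P : polyzJ) ^+ d.+1.
  by rewrite /alt -polyCD alt_polyS rmorphXn.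
have := branching_expansion ('X : polyzJ) alt0 altS k3.
move/(expansion_unique (gf_den_coef0 k 'X 'X%:P)) => FE.
rewrite /gf_coef -FE /series_of remove_expand.
have expE i : (i < 3)%N ->
    exponent [multinom part (conj_part la) j.+1 | j < k] i = col_count la i.
  move=> i3; rewrite /exponent; case: insubP => [j _ <-|].
    by rewrite mnmE part_conj_part.
  by rewrite -leqNgt => ki; rewrite cols // ki.
rewrite !expE //; apply: eq_bigr => e _.
by rewrite branching_polyC.
Qed.

Lemma half_coef_sum (q : {poly int}) t :
  \sum_(c < size q | t == c.*2) q`_c = if odd t then 0 else q`_(t./2).
Proof.
have [odd_t|even_t] := boolP (odd t).
  by rewrite big_pred0 // => c; apply/negbTE; apply: contraL odd_t => /eqP ->;
    rewrite odd_double.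
have tE : t = t./2.*2 by rewrite even_halfK.
have [t_lt|t_ge] := ltnP t./2 (size q); last first.
  rewrite nth_default // big1 // => c /eqP tc; move: t_ge.
  by rewrite tc doubleK leqNgt ltn_ord.
rewrite (big_pred1 (Ordinal t_lt)) // => c /=.
by rewrite {1}tE (inj_eq double_inj) eq_sym.
Qed.

Lemma shifted_coef_sum (C : numClosedFieldType) (a E : C) (I : finType)
    (P : pred I) (n : I -> nat) (h : I -> {poly int}) t :
  shifted_coef a (\sum_(e | P e) 'X ^+ n e * (h e)%:P) E t =
  \sum_(e | P e) (if E == a + (n e)%:R then
                    if odd t then 0 else (h e)`_(t./2) else 0).
Proof.
set p : polyzJ := \sum_(e | P e) 'X ^+ n e * (h e)%:P; rewrite /shifted_coef.
have coefp b : p`_b = \sum_(e | P e) (if b == n e then h e else 0).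
  rewrite coef_sum; apply: eq_bigr => e _; rewrite coefXnM coefC.
  case: ltngtP => [//|nb|->]; last by rewrite subnn.
  by rewrite subn_eq0 leqNgt nb.
(* A common range for b: the coefficients of [p] vanish from [size p] on, and every [n e] lies below
   [M]. *)
pose M := maxn (size p) (\max_e n e).+1.
under eq_bigr do rewrite half_coef_sum.
rewrite (big_ord_widen_cond M (fun b => E == a + b%:R)
  (fun b => if odd t then 0 else p`_b`_(t./2))) ?leq_maxl //.
rewrite big_mkcondr /=.
transitivity (\sum_(b < M | E == a + b%:R)
   \sum_(e | P e) (if odd t then 0 else if b == n e :> nat then (h e)`_(t./2) else 0)).
  apply: eq_bigr => b _; case: ifP => [_|/negbT b_ge].
    case: (odd t); first by rewrite big1.
    rewrite coefp coef_sum; apply: eq_bigr => e _.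
    by case: eqP => // _; rewrite coef0.
  have: p`_b = 0 by rewrite nth_default // leqNgt.
  move/(congr1 (fun q : {poly int} => q`_(t./2))).
  rewrite coefp coef_sum coef0 => p0.
  case: (odd t); first by rewrite big1.
  rewrite -[LHS]p0; apply: eq_bigr => e _.
  by case: eqP => // _; rewrite coef0.
rewrite exchange_big /=; apply: eq_bigr => e _.
have neM : (n e < M)%N.
  by apply: leq_trans (leq_maxr _ _); rewrite ltnS (leq_bigmax_cond e).
case: ifP => E_ne; last first.
  rewrite big1 // => b Eb; case: odd => //; case: eqP => // b_ne.
  by move: Eb; rewrite b_ne E_ne.
rewrite (bigD1 (Ordinal neM)) //= eqxx big1 ?addr0 // => b /andP[_ b_ne].
by rewrite -[n e]/(val (Ordinal neM)) val_eqE (negPf b_ne); case: odd.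
Qed.


(** * Comparison of weight multiplicities with the generating function *)

Section Character.
Variables (C : numClosedFieldType) (V : gl_rep C 3) (la : seq nat).
Hypotheses (la_partition : is_partition la) (la2 : (part la 2 <= 3)%N).
Hypothesis V_la : is_V_lambda la V.
Variables (hbar omega : C).
Hypothesis ho_neq0 : hbar * omega != 0.

Local Notation c := (col_count la).
Local Notation U E := (energy_space V hbar omega E).
Local Notation K t := (passmx.leigenspace (gl_H (u3 V)) (t%:R / 2)).

Lemma dim_energy_tableaux (E : C) t :
  Posz (\dim (U E :&: K t)%VS) =
  \sum_(nu <- bounded_seqs la | is_partition nu && horizontal_strip la nu)
    \sum_(T : {ffun cell (conj_part nu) -> 'I_3} | semistandard T)
      ((E == (sumn la)%:R / 2 + (sumn la - sumn nu)%:R) &&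
       ((letter_count T 0).*2 == (letter_count T 1).*2 + t)%N)%:R.
Proof.
have [[_ [N [f [f_inj f_act]]]] character] := V_la.
have N_lt : (N < (maxn N (sumn la)).+1)%N by rewrite ltnS leq_maxl.
have la_lt : (sumn la < (maxn N (sumn la)).+1)%N by rewrite ltnS leq_maxr.
rewrite (dim_energy_weight f_inj f_act N_lt _ _ ho_neq0).
rewrite (big_morph Posz PoszD (erefl _)).
under eq_bigr do rewrite character.
rewrite (super_schur_poly_sum (fun mu : 'X_{1..4} =>
  (E == (mdeg mu)%:R / 2 + (mu ord0)%:R) &&
  (t%:R / 2 == (mu (lift ord0 (ord0 : 'I_3)))%:R
               - (mu (lift ord0 (lift ord0 ord0 : 'I_3)))%:R)) la_lt).
apply: eq_bigr => nu /andP[pnu hs]; apply: eq_bigr => T _.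
rewrite (mdeg_tableau_weight T pnu hs) tableau_weight0 !tableau_weight_lift.
congr (nat_of_bool (_ && _))%:R.
have two0 : (2 : C) != 0 by rewrite pnatr_eq0.
set a := #|_|; set b := #|_|.
have -> : letter_count T 0 = a by apply: eq_card => x; rewrite !inE.
have -> : letter_count T 1 = b by apply: eq_card => x; rewrite !inE.
rewrite -(inj_eq (mulIf two0)) divfK // mulrBl eq_sym subr_eq -!natrM -natrD.
by rewrite eqr_nat !muln2 addnC.
Qed.

Definition strip_term (E : C) t (a0 a1 a2 : nat) : int :=
  if E == (sumn la)%:R / 2 + (sumn la - (a0 + a1 + a2))%:R then
    if odd t then 0 else (branch_poly a0 a1 a2)`_(t./2)
  else 0.

(** A [nu] with more than three columns has a conjugate with at least four rows and admits no
    tableau in three letters; [weight_difference] evaluates the others. *)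
Lemma dim_energy_difference E t :
  Posz (\dim (U E :&: K t)%VS) - Posz (\dim (U E :&: K t.+2)%VS) =
  \sum_(e : bool * bool * bool | [&& e.1.1 <= c 0, e.1.2 <= c 1 & e.2 <= c 2]%N)
     strip_term E t (c 0 - e.1.1) (c 1 - e.1.2) (c 2 - e.2).
Proof.
rewrite !dim_energy_tableaux -sumrB -strip_sum //; last first.
  by move=> a0 a1 a2 /branch_poly_strict b0; rewrite /strip_term b0 coef0;
    case: odd; case: eqP.
rewrite [RHS]big_mkcondr /=; apply: eq_bigr => nu /andP[pnu hs].
have pconj := conj_part_partition nu.
have nthE i : nth 0%N (conj_part nu) i = col_count nu i.
  by rewrite -part_conj_part.
case: leqP => [nu1|nu1]; last first.
  have rows (T : {ffun cell (conj_part nu) -> 'I_3}) : semistandard T = false.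
    apply: negbTE; apply: (semistandard_no_four_rows T pconj).
    by rewrite nthE lt_col_count.
  by rewrite !big_pred0 ?subrr // => T; rewrite rows.
rewrite -sumrB /strip_term -sumn_narrow //.
case: eqP => _ /=; last by rewrite big1 // => T _; rewrite subrr.
by rewrite weight_difference ?size_conj_part // !nthE.
Qed.

(** The truncated difference [part la 1 - 3] is 0 for first parts up to 3, which gives r^* = 0 in
    the cases with fewer variables. *)
Lemma gf_identity_columns k :
  (k <= 3)%N -> (forall i, (k <= i < 3)%N -> c i = 0%N) ->
  gf_identity hbar omega la V k (part la 1 - 3).
Proof.
move=> k3 cols E t; have [cov _] := V_la.
apply: covariant_so_multiplicity => //; apply/eqP; rewrite -subr_eq; apply/eqP.
rewrite dim_energy_difference gf_coefE // shifted_coef_sum.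
apply: eq_bigr => -[[e0 e1] e2] /and3P[/= e0c e1c e2c].
(* The removed boxes are those chosen by (e0, e1, e2) and the single box of each column beyond the
   third. *)
rewrite /strip_term -addrA -natrD; congr (if _ == _ + _%:R then _ else _).
by rewrite [in LHS](sumn_three_columns la_partition la2); lia.
Qed.

End Character.

Theorem mainTheorem5 (C : numClosedFieldType) (hbar omega : C)
    (hbar_gt0 : 0 < hbar) (omega_gt0 : 0 < omega)
    (la : seq nat) (la_partition : is_partition la)
    (la2_le3 : (part la 2 <= 3)%N)
    (V : gl_rep C 3) (V_la : is_V_lambda la V) :
  [/\ (3 <= part la 1)%N -> gf_identity hbar omega la V 3 (part la 1 - 3),
      part la 1 = 2%N -> gf_identity hbar omega la V 2 0 &
      part la 1 = 1%N -> gf_identity hbar omega la V 1 0].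
Proof.
have ho : hbar * omega != 0 by rewrite mulf_neq0 // gt_eqF.
have empty k i : part la 1 = k -> (k <= i < 3)%N -> col_count la i = 0%N.
  move=> la1 /andP[ki _]; apply/eqP; rewrite -leqn0 leqNgt lt_col_count //.
  by rewrite -leqNgt -[nth _ _ _]/(part la 1) la1.
have id := gf_identity_columns la_partition la2_le3 V_la ho.
split=> la1.
- by apply: id => // i; lia.
- by have := id 2%N isT (empty _ ^~ la1); rewrite la1.
- by have := id 1%N isT (empty _ ^~ la1); rewrite la1.
Qed.
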